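(* Consider either the multi-indexed Laguerre case (L) or the multi-indexed Jacobi case (J). Let $\mathcal D$ be a multi-index and $\mathcal N\ge1$ an integer. For every $\mathcal D'\in\mathcal{EP}$ the following identity of polynomials in $\eta$ holds: $$\Xi_{\mathcal D'}(\eta)\Bigl(\widetilde{\mathcal H}_{\mathcal D'}P_{\mathcal D,\mathcal N}(\eta)-\widetilde{\mathcal E}\,P_{\mathcal D,\mathcal N}(\eta)\Bigr)=\mathcal E''\,P_{\mathcal D',\mathcal N}(\eta)\,\Xi_{\mathcal D}(\eta),$$ where the constants $\widetilde{\mathcal E}$, $\mathcal E''$ (depending on $\mathcal D,\mathcal D',\mathcal N$) are - type I ($d_j^{\rm I}$ replaced by $\epsilon$): $\widetilde{\mathcal E}=\widetilde{\mathcal E}^{\rm I}(d_j^{\rm I})+\widetilde{\mathcal E}^{\rm I}(\epsilon)-\mathcal E(\mathcal N)$, $\ \mathcal E''=2\bigl(\mathcal E(\mathcal N)-\widetilde{\mathcal E}^{\rm I}(d_j^{\rm I})\bigr)$; - type II ($d_j^{\rm II}$ replaced by $\epsilon$): $\widetilde{\mathcal E}=\widetilde{\mathcal E}^{\rm II}(d_j^{\rm II})+\widetilde{\mathcal E}^{\rm II}(\epsilon)-\mathcal E(\mathcal N)$, $\ \mathcal E''=2\bigl(\mathcal E(\mathcal N)-\widetilde{\mathcal E}^{\rm II}(d_j^{\rm II})\bigr)$; - type III ($d_j^{\rm I}$ and $d_k^{\rm II}$ removed): $\widetilde{\mathcal E}=\widetilde{\mathcal E}^{\rm I}(d_j^{\rm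 I})+\widetilde{\mathcal E}^{\rm II}(d_k^{\rm II})-\mathcal E(\mathcal N)$, $\ \mathcal E''=-\frac1\gamma\bigl(\mathcal E(\mathcal N)-\widetilde{\mathcal E}^{\rm I}(d_j^{\rm I})\bigr)\bigl(\mathcal E(\mathcal N)-\widetilde{\mathcal E}^{\rm II}(d_k^{\rm II})\bigr)$, with $\gamma=2$ in case L and $\gamma=8$ in case J.
   Context: **Multi-index and parameters.** $\mathcal D=\mathcal D^{\rm I}\cup\mathcal D^{\rm II}$, $\mathcal D^{\rm I}=\{d_1^{\rm I}<\dots<d_M^{\rm I}\}$, $\mathcal D^{\rm II}=\{d_1^{\rm II}<\dots<d_N^{\rm II}\}$, positive integers, $M,N\ge0$, $M+N\ge1$ (the labels I and II are part of the data). Real parameters: $g$ in case L, with $g>\max\{N+\frac32,\,d_j^{\rm II}+\frac12\}$; $(g,h)$ in case J, with $g>\max\{N+2,\,d_j^{\rm II}+\frac12\}$, $h>\max\{M+2,\,d_j^{\rm I}+\frac12\}$. **Energies.** L: $\mathcal E(n)=4n$, $\widetilde{\mathcal E}^{\rm I}({\rm v})=-4(g+{\rm v}+\frac12)$, $\widetilde{\mathcal E}^{\rm II}({\rm v})=-4(g-{\rm v}-\frac12)$. J: $\mathcal E(n)=4n(n+g+h)$, $\widetilde{\mathcal E}^{\rm I}({\rm v})=-4(g+{\rm v}+\frac12)(h-{\rm v}-\frac12)$, $\widetilde{\mathcal E}^{\rm II}({\rm v})=-4(g-{\rm v}-\frac12)(h+{\rm v}+\frac12)$. **Polynomials.** $P_n=L_n^{(g-1/2)}$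 (Laguerre, L), $P_n=P_n^{(g-1/2,h-1/2)}$ (Jacobi, J). For an integer ${\rm v}\ge 0$ put - L: $\mu^{\rm I}_{\rm v}(\eta)=e^{\eta}L^{(g-1/2)}_{\rm v}(-\eta)$, $\ \mu^{\rm II}_{\rm v}(\eta)=\eta^{1/2-g}L^{(1/2-g)}_{\rm v}(\eta)$; - J: $\mu^{\rm I}_{\rm v}(\eta)=\bigl(\frac{1+\eta}2\bigr)^{1/2-h}P^{(g-1/2,1/2-h)}_{\rm v}(\eta)$, $\ \mu^{\rm II}_{\rm v}(\eta)=\bigl(\frac{1-\eta}2\bigr)^{1/2-g}P^{(1/2-g,h-1/2)}_{\rm v}(\eta)$. ${\rm W}[f_1,\dots,f_r]=\det(d^{i-1}f_j/d\eta^{i-1})_{1\le i,j\le r}$ ($=1$ for $r=0$). For an index pair $\mathcal A=(a_1,\dots,a_p;b_1,\dots,b_q)$ (distinct non-negative integers $a_i$ of type I, distinct non-negative integers $b_i$ of type II) define the polynomials $$\Xi_{\mathcal A}(\eta)={\rm W}[\mu^{\rm I}_{a_1},\dots,\mu^{\rm I}_{a_p},\mu^{\rm II}_{b_1},\dots,\mu^{\rm II}_{b_q}]\times\begin{cases}\eta^{(p+g-\frac12)q}e^{-p\eta}&\text{L}\\ \bigl(\frac{1-\eta}2\bigr)^{(p+g-\frac12)q}\bigl(\frac{1+\eta}2\bigr)^{(q+h-\frac12)p}&\text{J}\end{cases}$$ $$P_{\mathcal A,n}(\eta)={\rm W}[\mu^{\rm I}_{a_1},\dots,\mu^{\rm I}_{a_p},\mu^{\rm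 II}_{b_1},\dots,\mu^{\rm II}_{b_q},P_n]\times\begin{cases}\eta^{(p+g+\frac12)q}e^{-p\eta}&\text{L}\\ \bigl(\frac{1-\eta}2\bigr)^{(p+g+\frac12)q}\bigl(\frac{1+\eta}2\bigr)^{(q+h+\frac12)p}&\text{J}\end{cases}$$ (formulas read on $0<\eta<\infty$ for L, $-1<\eta<1$ for J). $\mathcal D$ is identified with $(d^{\rm I}_1,\dots,d^{\rm I}_M;d^{\rm II}_1,\dots,d^{\rm II}_N)$. **Differential operators.** $c_2(\eta)=\eta$ (L), $1-\eta^2$ (J). Put $c_1(\eta;g)=g+\frac12-\eta$ (L), $c_1(\eta;g,h)=h-g-(g+h+1)\eta$ (J). For an index pair $\mathcal A$ with $p$ type I and $q$ type II entries let $C_1$ be $c_1$ with parameters shifted to $g+p-q$ (L), $(g+p-q,h-p+q)$ (J), and $C_1^-$ be $c_1$ with parameters $g+p-q-1$ (L), $(g+p-q-1,h-p+q-1)$ (J). Then $$\widetilde{\mathcal H}_{\mathcal A}=-4\Bigl(c_2\frac{d^2}{d\eta^2}+\Bigl(C_1-2c_2\frac{\Xi_{\mathcal A}'}{\Xi_{\mathcal A}}\Bigr)\frac{d}{d\eta}+c_2\frac{\Xi_{\mathcal A}''}{\Xi_{\mathcal A}}-C_1^-\frac{\Xi_{\mathcal A}'}{\Xi_{\mathcal A}}\Bigr).$$ **The set $\mathcal{EP}$** consists of the following index pairs $\mathcal D'$: - type I: $\mathcal D$ with one entry $d_j^{\rm I}$ replaced (in the same position) by some integer $\epsilon$ with $0\le\epsilon<d_j^{\rm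 I}$, $\epsilon\notin\mathcal D^{\rm I}$; - type II: $\mathcal D$ with one entry $d_j^{\rm II}$ replaced (in the same position) by some integer $\epsilon$ with $0\le\epsilon<d_j^{\rm II}$, $\epsilon\notin\mathcal D^{\rm II}$; - type III: $\mathcal D$ with one entry $d_j^{\rm I}$ and one entry $d_k^{\rm II}$ both removed. *)

(* Defs.v *)
From HB Require Import structures.
From mathcomp Require Import all_boot all_order all_algebra.
From mathcomp Require Import all_classical all_reals all_analysis.

Set Implicit Arguments.
Unset Strict Implicit.
Unset Printing Implicit Defensive.
Import Order.TTheory GRing.Theory Num.Theory.
Local Open Scope ring_scope.

(* The two cases L and J, together with their real parameters. *)
Inductive params (R : Type) : Type :=
  | Laguerre (g : R)
  | Jacobi (g h : R).

(* An index pair (a_1,...,a_p; b_1,...,b_q). The order of the entries matters,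
   since it fixes the signs of the Wronskians. *)
Record index_pair : Type := IndexPair { typeI : seq nat; typeII : seq nat }.

Definition multi_index (D : index_pair) : bool :=
  [&& sorted ltn (typeI D), sorted ltn (typeII D),
      all (leq 1) (typeI D), all (leq 1) (typeII D) &
      (1 <= size (typeI D) + size (typeII D))%N].

Section MultiIndexed.
Variable R : realType.
Implicit Types (c : params R) (A D : index_pair) (g h : R).

Definition admissible c D : Prop :=
  let M : R := (size (typeI D))%:R in
  let N : R := (size (typeII D))%:R in
  match c with
  | Laguerre g =>
      N + 3 / 2 < g /\ {in typeII D, forall d : nat, d%:R + 2^-1 < g}
  | Jacobi g h =>
      [/\ N + 2 < g, {in typeII D, forall d : nat, d%:R + 2^-1 < g},
          M + 2 < h & {in typeI D, forall d : nat, d%:R + 2^-1 < h}]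
  end.

Definition energy c (n : nat) : R :=
  match c with
  | Laguerre _ => 4 * n%:R
  | Jacobi g h => 4 * n%:R * (n%:R + g + h)
  end.

Definition energyI c (v : nat) : R :=
  match c with
  | Laguerre g => - 4 * (g + v%:R + 2^-1)
  | Jacobi g h => - 4 * (g + v%:R + 2^-1) * (h - v%:R - 2^-1)
  end.

Definition energyII c (v : nat) : R :=
  match c with
  | Laguerre g => - 4 * (g - v%:R - 2^-1)
  | Jacobi g h => - 4 * (g - v%:R - 2^-1) * (h + v%:R + 2^-1)
  end.

Definition pochhammer (a : R) (k : nat) : R := \prod_(i < k) (a + i%:R).

(* The usual hypergeometric sums for the Laguerre and Jacobi polynomials, with
   the quotient (a+1)_n / (a+1)_k written as (a+k+1)_(n-k), so that they are
   meaningful for all real a and b. *)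
Definition laguerre (n : nat) (a : R) : {poly R} :=
  \sum_(k < n.+1)
    ((-1) ^+ k * pochhammer (a + k%:R + 1) (n - k) / (k`! * (n - k)`!)%:R)
      *: 'X^k.

Definition jacobi (n : nat) (a b : R) : {poly R} :=
  \sum_(k < n.+1)
    (pochhammer (n%:R + a + b + 1) k * pochhammer (a + k%:R + 1) (n - k)
       / (k`! * (n - k)`!)%:R)
      *: (2^-1 *: ('X - 1)) ^+ k.

Definition eigenpoly c (n : nat) : {poly R} :=
  match c with
  | Laguerre g => laguerre n (g - 2^-1)
  | Jacobi g h => jacobi n (g - 2^-1) (h - 2^-1)
  end.

(* The functions below are only meaningful on this interval: [powR] takes junk
   values at a non-positive base. *)
Definition domain c (x : R) : Prop :=
  match c with
  | Laguerre _ => 0 < x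
  | Jacobi _ _ => -1 < x < 1
  end.

Definition muI c (v : nat) (x : R) : R :=
  match c with
  | Laguerre g => expR x * (laguerre v (g - 2^-1)).[- x]
  | Jacobi g h =>
      powR ((1 + x) / 2) (2^-1 - h) * (jacobi v (g - 2^-1) (2^-1 - h)).[x]
  end.

Definition muII c (v : nat) (x : R) : R :=
  match c with
  | Laguerre g => powR x (2^-1 - g) * (laguerre v (2^-1 - g)).[x]
  | Jacobi g h =>
      powR ((1 - x) / 2) (2^-1 - g) * (jacobi v (2^-1 - g) (h - 2^-1)).[x]
  end.

Definition wronskian (fs : seq (R -> R)) (x : R) : R :=
  \det (\matrix_(i < size fs, j < size fs)
          derive1n i (nth (fun _ => 0) fs j) x).

Definition seeds c A : seq (R -> R) :=
  map (muI c) (typeI A) ++ map (muII c) (typeII A).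

(* Common prefactor of Xi_A (s = -1/2) and P_{A,n} (s = 1/2). *)
Definition prefactor c A (s x : R) : R :=
  let p : R := (size (typeI A))%:R in
  let q : R := (size (typeII A))%:R in
  match c with
  | Laguerre g => powR x ((p + g + s) * q) * expR (- (p * x))
  | Jacobi g h =>
      powR ((1 - x) / 2) ((p + g + s) * q) * powR ((1 + x) / 2) ((q + h + s) * p)
  end.

Definition Xi_fun c A (x : R) : R :=
  wronskian (seeds c A) x * prefactor c A (- 2^-1) x.

Definition P_fun c A (n : nat) (x : R) : R :=
  wronskian (rcons (seeds c A) (horner (eigenpoly c n))) x
  * prefactor c A 2^-1 x.

(* The domain is infinite, so at most one polynomial satisfies this. *)
Definition is_polynomial_of c (f : R -> R) (p : {poly R}) : Prop :=
  forall x : R, domain c x -> p.[x] = f x.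

Definition is_Xi c A : {poly R} -> Prop := is_polynomial_of c (Xi_fun c A).

Definition is_P c A (n : nat) : {poly R} -> Prop :=
  is_polynomial_of c (P_fun c A n).

Definition c2 c : {poly R} :=
  match c with
  | Laguerre _ => 'X
  | Jacobi _ _ => 1 - 'X^2
  end.

Definition c1 c : {poly R} :=
  match c with
  | Laguerre g => (g + 2^-1)%:P - 'X
  | Jacobi g h => (h - g)%:P - (g + h + 1) *: 'X
  end.

Definition shift c (a b : R) : params R :=
  match c with
  | Laguerre g => Laguerre (g + a)
  | Jacobi g h => Jacobi (g + a) (h + b)
  end.

Definition C1 c A : {poly R} :=
  let p : R := (size (typeI A))%:R in
  let q : R := (size (typeII A))%:R in
  c1 (shift c (p - q) (q - p)).

Definition C1m c A : {poly R} :=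
  let p : R := (size (typeI A))%:R in
  let q : R := (size (typeII A))%:R in
  c1 (shift c (p - q - 1) (q - p - 1)).

Definition toF : {poly R} -> {fraction {poly R}} := @tofrac {poly R}.

(* The action of the operator H~_A on a polynomial f, as a rational function;
   xi stands for the polynomial Xi_A. *)
Definition Htilde c A (xi f : {poly R}) : {fraction {poly R}} :=
  - 4 * (toF (c2 c) * toF f^`(2)
         + (toF (C1 c A) - 2 * toF (c2 c) * (toF xi^`() / toF xi)) * toF f^`()
         + (toF (c2 c) * (toF xi^`(2) / toF xi)
            - toF (C1m c A) * (toF xi^`() / toF xi)) * toF f).

Definition gamma c : R :=
  match c with
  | Laguerre _ => 2
  | Jacobi _ _ => 8
  end.

Definition replace (d e : nat) (s : seq nat) : seq nat :=
  [seq if x == d then e else x | x <- s].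

(* [EP c D n D' Et E2]: the index pair D' belongs to the set EP of D, and
   Et, E2 are the constants E~, E'' attached to D, D' and n. *)
Inductive EP c D (n : nat) : index_pair -> R -> R -> Prop :=
  | EP_typeI (d e : nat) of d \in typeI D & (e < d)%N & e \notin typeI D :
      EP c D n (IndexPair (replace d e (typeI D)) (typeII D))
        (energyI c d + energyI c e - energy c n)
        (2 * (energy c n - energyI c d))
  | EP_typeII (d e : nat) of d \in typeII D & (e < d)%N & e \notin typeII D :
      EP c D n (IndexPair (typeI D) (replace d e (typeII D)))
        (energyII c d + energyII c e - energy c n)
        (2 * (energy c n - energyII c d))
  | EP_typeIII (d k : nat) of d \in typeI D & k \in typeII D :
      EP c D n (IndexPair (rem d (typeI D)) (rem k (typeII D)))
        (energyI c d + energyII c k - energy c n)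
        (- (gamma c)^-1 * (energy c n - energyI c d) * (energy c n - energyII c k)).

End MultiIndexed.

(* Main.v *)
(* Every seed function and every eigenpolynomial solves c2 f'' + c1 f' = l f with the same
   c2 (quadratic) and c1 (linear), where l = - energy / 4.  Applying this operator column by
   column to a Wronskian W multiplies W by the sum of the eigenvalues; because of the degrees
   of c2 and c1 the result only involves W, W' and W_2 - W_11, where W_2 and W_11 are the
   two determinants with shifted rows whose sum is W''.  The Wronskians of F together with
   one, two or three of the functions a, b, c satisfy Pluecker relations, also when their
   rows are shifted, and these turn the eigenvalue relations into the bilinear identities of
   the theorem: types I and II exchange one column of F + [a], type III removes two columns
   from F + [a; b].  The Pluecker relations reduce to a single common column, where they are
   polynomial identities.  No Wronskian has to be nonzero, because after multiplication by
   Xi_D' the theorem is bilinear in Xi_D' and P_D.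

   Xi and P are polynomials because, once the denominators are cleared column by column,
   the determinant is divisible by the power of 1 + x, 1 - x or x that was introduced:
   seeds of the same type can be combined so as to vanish to orders 0, 1, 2, ... there. *)
Require Import Defs.
From HB Require Import structures.
From mathcomp Require Import all_boot all_order all_fingroup all_algebra.
From mathcomp Require Import all_classical all_reals all_analysis.
From mathcomp Require Import zify ring lra.

Set Implicit Arguments.
Unset Strict Implicit.
Unset Printing Implicit Defensive.
Import Order.TTheory GRing.Theory Num.Theory.
Import numFieldNormedType.Exports.
Local Open Scope ring_scope.

(** * Determinants indexed by natural numbers *)

(** The obstacle is a sign. The eigenvalue relations only provide W_2 - W_11, while a second
    derivative is W_2 + W_11. The two are reconciled only in bilinear expressions of Hirota type, U
    V'' - 2 U' V' + U'' V, and this is what the operator becomes once denominators are cleared. The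
    simplest Pluecker relations are Laplace expansions of a 3 by 3 determinant left after the
    columns F are eliminated: they give 0 when a row is repeated and W[F] W[F,a,b,c] up to sign
    otherwise. For an exchange these products cancel in the end. For a removal they are the main
    term, and isolating a single product W[F,c] W[F,a,b] takes three relations with different
    eigenvalue weights, hence the quadratic constant of type III.

    The bilinear identities are proved for arbitrary sequences of numbers satisfying the
    differentiated equation at one point. Analysis enters only to identify these sequences with
    derivatives and to differentiate Wronskians and prefactors. *)

Section NatMatrix.
Variable R : comNzRingType.
Implicit Types A B : nat -> nat -> R.

(* Square matrices indexed by nat, so that their size can be rewritten. *)
Definition natmx n A : 'M[R]_n := \matrix_(i, j) A i j.
Definition natdet n A : R := \det (natmx n A).

Lemma eq_natdet n A B :
  (forall i j, (i < n)%N -> (j < n)%N -> A i j = B i j) ->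
  natdet n A = natdet n B.
Proof. by move=> AB; congr (\det _); apply/matrixP => i j; rewrite !mxE AB. Qed.

Lemma natdet_tr n A : natdet n A = natdet n (fun i j => A j i).
Proof.
by rewrite /natdet -det_tr; congr (\det _); apply/matrixP => i j; rewrite !mxE.
Qed.

Lemma natdet0 A : natdet 0 A = 1.
Proof. exact: det_mx00. Qed.

Lemma natdet_row_expand n A (b : nat -> R) (k : 'I_n) :
  natdet n (fun i j => if i == k :> nat then b j else A i j) =
  \sum_(j < n) b j * cofactor (natmx n A) k j.
Proof.
rewrite /natdet (expand_det_row _ k); apply: eq_bigr => j _.
rewrite mxE eqxx; congr (_ * _); rewrite /cofactor; congr (_ * \det _).
by apply/matrixP => i l; rewrite !mxE eq_sym (negbTE (neq_bump _ _)).
Qed.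

Lemma natdet_row0 n A (k : nat) :
  (k < n)%N -> (forall j, (j < n)%N -> A k j = 0) -> natdet n A = 0.
Proof.
move=> kn A0; rewrite /natdet (expand_det_row _ (Ordinal kn)) big1 // => j _.
by rewrite mxE /= A0 // mul0r.
Qed.

Lemma natdet_col0 n A (k : nat) :
  (k < n)%N -> (forall i, (i < n)%N -> A i k = 0) -> natdet n A = 0.
Proof.
move=> kn A0; rewrite /natdet (expand_det_col _ (Ordinal kn)) big1 // => j _.
by rewrite mxE /= A0 // mul0r.
Qed.

Lemma natdet_dup n A (k l : nat) :
  (k < n)%N -> (l < n)%N -> k != l ->
  (forall j, (j < n)%N -> A k j = A l j) -> natdet n A = 0.
Proof.
move=> kn ln kl Akl.
apply: (@determinant_alternate _ _ _ (Ordinal kn) (Ordinal ln)) => // j.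
by rewrite !mxE Akl.
Qed.

Lemma natdet_swap_rows n A (k l : nat) :
  (k < n)%N -> (l < n)%N -> k != l ->
  natdet n (fun i j => if i == k then A l j else if i == l then A k j else A i j)
  = - natdet n A.
Proof.
move=> kn ln kl; pose K := Ordinal kn; pose L := Ordinal ln.
have -> : natdet n (fun i j =>
    if i == k then A l j else if i == l then A k j else A i j)
  = \det (xrow K L (natmx n A)).
  congr (\det _); apply/matrixP => i j; rewrite !mxE.
  case: tpermP => [->|->|/eqP iK /eqP iL] /=; first by rewrite eqxx.
    by rewrite eqxx eq_sym (negbTE kl).
  by rewrite -val_eqE in iK; rewrite -val_eqE in iL; rewrite (negbTE iK) (negbTE iL).
by rewrite xrowE det_mulmx det_perm odd_tperm (_ : K != L) // mulN1r.
Qed.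

Lemma natdet_swap_cols n A (k l : nat) :
  (k < n)%N -> (l < n)%N -> k != l ->
  natdet n (fun i j => A i (if j == k then l else if j == l then k else j))
  = - natdet n A.
Proof.
move=> kn ln kl.
rewrite natdet_tr (natdet_tr _ A) -(natdet_swap_rows _ kn ln kl).
by apply: eq_natdet => i j _ _; do 2?case: ifP.
Qed.

(** Scaling column j by 1 + t l_j multiplies the determinant by the product of these factors; the
    identity compares the coefficients of t. It turns an eigenvalue per column into an operation on
    rows. *)
Lemma natdet_sum_rows n A B (l : nat -> R) :
  (forall i j, (i < n)%N -> (j < n)%N -> B i j = l j * A i j) ->
  (\sum_(j < n) l j) * natdet n A =
  \sum_(k < n) natdet n (fun i j => if i == k :> nat then B k j else A i j).
Proof.
move=> BA; rewrite mulr_suml.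
under [RHS]eq_bigr do rewrite natdet_row_expand.
rewrite exchange_big; apply: eq_bigr => j _.
rewrite /natdet (expand_det_col _ j) mulr_sumr; apply: eq_bigr => i _.
by rewrite BA // mxE mulrA.
Qed.

Lemma natdet_col_add n A (b : nat -> R) (t : R) :
  natdet n.+1 (fun i j => if j == 0%N then A i j + t * b i else A i j) =
  natdet n.+1 A + t * natdet n.+1 (fun i j => if j == 0%N then b i else A i j).
Proof.
rewrite /natdet !(expand_det_col _ ord0) mulr_sumr -big_split.
apply: eq_bigr => i _; rewrite !mxE /= mulrDl -[t * b i * _]mulrA.
by congr (_ * _ + _ * (_ * _)); rewrite /cofactor; congr (_ * \det _);
  apply/matrixP => k l; rewrite !mxE.
Qed.

Lemma natdet_col_delta n A :
  (forall i, A i.+1 0%N = 0) ->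
  natdet n.+1 A = A 0%N 0%N * natdet n (fun i j => A i.+1 j.+1).
Proof.
move=> A0; rewrite /natdet (expand_det_col _ ord0) big_ord_recl big1 => [|i _].
  rewrite addr0 mxE /= /cofactor addn0 expr0 mul1r; congr (_ * \det _).
  by apply/matrixP => i j; rewrite !mxE.
by rewrite mxE A0 mul0r.
Qed.

End NatMatrix.

Section Pivot.
Variable R : fieldType.
Implicit Types A : nat -> nat -> R.

(** Schur complement of the corner entry; [U] performs the column operations that clear the rest of
    the first row. *)
Lemma natdet_pivot n A : A 0%N 0%N != 0 ->
  natdet n.+1 A = A 0%N 0%N * natdet n
    (fun i j => A i.+1 j.+1 - A 0%N j.+1 / A 0%N 0%N * A i.+1 0%N).
Proof.
move=> A00; pose a j := if j is j'.+1 then A 0%N j / A 0%N 0%N else 0.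
pose U i j : R := (i == j :> nat)%:R - (i == 0%N)%:R * a j.
have dU : natdet n.+1 U = 1.
  rewrite natdet_col_delta => [|i]; last by rewrite /U /= mul0r subr0.
  rewrite /U /= mulr0 subr0 mul1r -[RHS](det1 R n); congr (\det _).
  by apply/matrixP => i j; rewrite !mxE mul0r subr0.
have E : natmx n.+1 A *m natmx n.+1 U = natmx n.+1 (fun i j => A i j - a j * A i 0%N).
  apply/matrixP => i j; rewrite !mxE.
  under eq_bigr do rewrite !mxE /U mulrBr.
  rewrite big_split /= (bigD1 j) //= eqxx mulr1 big1 ?addr0 => [|k kj]; last first.
    by rewrite val_eqE (negbTE kj) mulr0.
  rewrite big_ord_recl /= mul1r big1 ?addr0 => [|k _]; first by rewrite mulrC.
  by rewrite mul0r mulr0 oppr0.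
have -> : natdet n.+1 A = \det (natmx n.+1 A *m natmx n.+1 U).
  by rewrite det_mulmx -/(natdet _ U) dU mulr1.
rewrite E -/(natdet _ _).
rewrite natdet_tr natdet_col_delta => [|i]; last by rewrite /= divfK ?subrr.
by rewrite natdet_tr /= mul0r subr0.
Qed.

End Pivot.

(** * Lifting bilinear determinantal identities *)

Lemma natdet1 (R : comNzRingType) (A : nat -> nat -> R) : natdet 1 A = A 0%N 0%N.
Proof. by rewrite /natdet det_mx11 mxE. Qed.

Lemma natdet_expand (R : comNzRingType) n (A : nat -> nat -> R) :
  natdet n.+1 A = \sum_(i < n.+1)
    (-1) ^+ i * A i 0%N * natdet n (fun k j => A (bump i k) j.+1).
Proof.
rewrite /natdet (expand_det_col _ ord0); apply: eq_bigr => i _.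
rewrite mxE /cofactor addn0 mulrCA mulrA; congr (_ * \det _).
by apply/matrixP => k j; rewrite !mxE.
Qed.

Section Lifting.
Variable R : numFieldType.
Implicit Types (v : nat -> nat -> R) (s : seq nat).

(* [v j i] is the [i]-th entry of the vector [v j]. *)
Definition minor v (p : seq nat * seq nat) : R :=
  natdet (size p.1) (fun i j => v (nth 0%N p.2 j) (nth 0%N p.1 i)).

Definition bilinear_form v (ts : seq (R * (seq nat * seq nat) * (seq nat * seq nat))) : R :=
  \sum_(t <- ts) t.1.1 * minor v t.1.2 * minor v t.2.

Definition lift_idx s := 0%N :: map S s.

Definition lift_minor (p : seq nat * seq nat) := (lift_idx p.1, lift_idx p.2).

Definition lift_term (t : R * (seq nat * seq nat) * (seq nat * seq nat)) :=
  (t.1.1, lift_minor t.1.2, lift_minor t.2).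

Definition square (p : seq nat * seq nat) := size p.1 == size p.2.

Lemma nth_lift_idx s (i : nat) :
  nth 0%N (lift_idx s) i =
  if i is i'.+1 then if (i' < size s)%N then (nth 0%N s i').+1 else 0%N else 0%N.
Proof.
case: i => // i /=; case: ltnP => [h|h]; first by rewrite (nth_map 0%N).
by rewrite nth_default // size_map.
Qed.

Lemma minor_lift_pivot v p : square p -> v 0%N 0%N != 0 ->
  minor v (lift_minor p) = v 0%N 0%N * minor
    (fun j i => v j.+1 i.+1 - v j.+1 0%N / v 0%N 0%N * v 0%N i.+1) p.
Proof.
move=> /eqP sp v0; rewrite /minor /= size_map natdet_pivot //; congr (_ * _).
by apply: eq_natdet => i j hi hj; rewrite /= !(nth_map 0%N) -?sp.
Qed.

(** Linearity in the first column: with a unit vector there, the lifted minor collapses to an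
    unlifted one. This allows a zero pivot to be perturbed. *)
Lemma minor_lift_add v p t : square p ->
  minor (fun j i => if j == 0%N then v j i + t * (i == 0%N)%:R else v j i)
    (lift_minor p) =
  minor v (lift_minor p) + t * minor (fun j i => v j.+1 i.+1) p.
Proof.
move=> /eqP sp; rewrite /minor /= size_map.
pose A i j := v (nth 0%N (lift_idx p.2) j) (nth 0%N (lift_idx p.1) i).
pose b i : R := (nth 0%N (lift_idx p.1) i == 0%N)%:R.
rewrite -(@eq_natdet _ _
  (fun i j => if j == 0%N then A i j + t * b i else A i j)); last first.
  by move=> i [|j] hi hj //=; rewrite /A /= (nth_map 0%N) -?sp.
rewrite natdet_col_add; congr (_ + _ * _).
rewrite (@eq_natdet _ _ _ (fun i j => if j == 0%N then (i == 0%N)%:R else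
   if i is i'.+1 then v (nth 0%N p.2 j.-1).+1 (nth 0%N p.1 i').+1 else A i j)).
  by rewrite natdet_col_delta //= mul1r.
move=> [|i] [|j] hi hj //; first by rewrite /b nth_lift_idx; rewrite ltnS in hi; rewrite hi.
by rewrite /A !nth_lift_idx -sp; rewrite !ltnS in hi hj; rewrite hi hj.
Qed.

(* A common column [f] and a common first row are added to both minors. When
   [f 0 <> 0] eliminating with this pivot leads back to the original identity;
   when [f 0 = 0] the form is quadratic in [t] along [f + t delta_0], and it
   vanishes at [t = 1] and [t = -1] while its leading coefficient is 0. *)
Lemma bilinear_form_lift ts :
  all (fun t => square t.1.2 && square t.2) ts ->
  (forall v, bilinear_form v ts = 0) ->
  forall v, bilinear_form v (map lift_term ts) = 0.
Proof.
move=> sq H.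
have pivot v : v 0%N 0%N != 0 -> bilinear_form v (map lift_term ts) = 0.
  move=> v0; rewrite /bilinear_form big_map.
  pose v' j i := v j.+1 i.+1 - v j.+1 0%N / v 0%N 0%N * v 0%N i.+1.
  transitivity (v 0%N 0%N ^+ 2 * bilinear_form v' ts); last by rewrite H mulr0.
  rewrite /bilinear_form mulr_sumr big_seq [RHS]big_seq; apply: eq_bigr => t tts.
  have /andP[s1 s2] := allP sq _ tts.
  by rewrite /= !minor_lift_pivot //; ring.
move=> v; have [v0|] := eqVneq (v 0%N 0%N) 0; last exact: pivot.
pose vt t j i := if j == 0%N then v j i + t * (i == 0%N)%:R else v j i.
pose v' j i := v j.+1 i.+1.
pose C1 := \sum_(t <- ts) t.1.1 * (minor v (lift_minor t.1.2) * minor v' t.2 +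
  minor v' t.1.2 * minor v (lift_minor t.2)).
have E t : bilinear_form (vt t) (map lift_term ts) =
    bilinear_form v (map lift_term ts) + t * C1 + t ^+ 2 * bilinear_form v' ts.
  rewrite /bilinear_form /C1 !big_map !mulr_sumr -!big_split /=.
  rewrite big_seq [RHS]big_seq; apply: eq_bigr => u uts.
  have /andP[s1 s2] := allP sq _ uts.
  by rewrite /= !minor_lift_add //; ring.
have E1 := E 1; have E2 := E (-1).
rewrite H mulr0 addr0 pivot ?oner_neq0 /vt /= ?v0 ?add0r ?mulr1 ?oner_neq0 // in E1.
rewrite H mulr0 addr0 pivot /vt /= ?v0 ?add0r ?mulr1 ?oppr_eq0 ?oner_neq0 // in E2.
have : 2 * bilinear_form v (map lift_term ts) = 0.
  have -> : 2 * bilinear_form v (map lift_term ts) =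
    (bilinear_form v (map lift_term ts) + 1 * C1) +
    (bilinear_form v (map lift_term ts) + - 1 * C1) by ring.
  by rewrite -E1 -E2 addr0.
by move/eqP; rewrite mulf_eq0 pnatr_eq0 /= => /eqP.
Qed.

Lemma square_lift p : square (lift_minor p) = square p.
Proof. by rewrite /square /= !size_map eqSS. Qed.

Lemma bilinear_form_lifts m ts :
  (forall v, bilinear_form v ts = 0) ->
  all (fun t => square t.1.2 && square t.2) ts ->
  forall v, bilinear_form v (map (iter m lift_term) ts) = 0.
Proof.
move=> H sq; elim: m => [|m IH] v /=.
  by rewrite -[RHS](H v); congr bilinear_form; exact: map_id.
rewrite (_ : map _ ts = map lift_term (map (iter m lift_term) ts)).
  apply: bilinear_form_lift => //; rewrite all_map; apply: sub_all sq => t /= h.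
  by elim: m {IH} => //= m IH; rewrite !square_lift.
by rewrite -map_comp.
Qed.

Lemma size_iter_lift_idx m s : size (iter m lift_idx s) = (m + size s)%N.
Proof. by elim: m => //= m IH; rewrite size_map IH. Qed.

Lemma nth_iter_lift_idx m s i : (i < m + size s)%N ->
  nth 0%N (iter m lift_idx s) i =
  if (i < m)%N then i else (nth 0%N s (i - m) + m)%N.
Proof.
elim: m i => [|m IH] i /=; first by rewrite subn0 addn0.
case: i => // i; rewrite addSn !ltnS subSS => h.
rewrite /= (nth_map 0%N) ?size_iter_lift_idx // IH //.
by case: ifP => //; rewrite addnS.
Qed.

Lemma iter_lift_minor m p :
  iter m lift_minor p = (iter m lift_idx p.1, iter m lift_idx p.2).
Proof. by elim: m => [|m IH] /=; [case: p | rewrite IH]. Qed.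

Lemma minor_iter_lift v m p : minor v (iter m lift_minor p) =
  natdet (m + size p.1) (fun i j => v (nth 0%N (iter m lift_idx p.2) j)
    (nth 0%N (iter m lift_idx p.1) i)).
Proof. by rewrite /minor iter_lift_minor /= size_iter_lift_idx. Qed.

Lemma iter_lift_term m t :
  iter m lift_term t = (t.1.1, iter m lift_minor t.1.2, iter m lift_minor t.2).
Proof. by elim: m => [|m IH] /=; [case: t => [[? ?] ?] | rewrite IH]. Qed.

End Lifting.

Lemma natdet2 (R : comNzRingType) (A : nat -> nat -> R) :
  natdet 2 A = A 0%N 0%N * A 1%N 1%N - A 1%N 0%N * A 0%N 1%N.
Proof.
by rewrite natdet_expand !big_ord_recl big_ord0 !natdet1 /=; ring.
Qed.

Lemma natdet3 (R : comNzRingType) (A : nat -> nat -> R) :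
  natdet 3 A =
    A 0%N 0%N * (A 1%N 1%N * A 2%N 2%N - A 2%N 1%N * A 1%N 2%N)
  - A 1%N 0%N * (A 0%N 1%N * A 2%N 2%N - A 2%N 1%N * A 0%N 2%N)
  + A 2%N 0%N * (A 0%N 1%N * A 1%N 2%N - A 1%N 1%N * A 0%N 2%N).
Proof.
by rewrite natdet_expand !big_ord_recl big_ord0 !natdet2 /= /bump /=; ring.
Qed.

Lemma natdet4 (R : comNzRingType) (A : nat -> nat -> R) :
  natdet 4 A =
    A 0%N 0%N * natdet 3 (fun i j => A i.+1 j.+1)
  - A 1%N 0%N * natdet 3 (fun i j => A (bump 1 i) j.+1)
  + A 2%N 0%N * natdet 3 (fun i j => A (bump 2 i) j.+1)
  - A 3%N 0%N * natdet 3 (fun i j => A (bump 3 i) j.+1).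
Proof.
rewrite natdet_expand !big_ord_recl big_ord0 /=.
have -> : natdet 3 (fun k j => A (bump 0 k) j.+1) = natdet 3 (fun i j => A i.+1 j.+1) by [].
by rewrite /bump /=; ring.
Qed.

(** * Pluecker relations with one common column *)

Section Pluecker.
Variable R : numFieldType.
Implicit Types v : nat -> nat -> R.

(* Row and column selections for one common column [0], in which
   [t], [s] are the amounts by which the last two rows are shifted down. *)
Definition sel0 (s : nat) : seq nat * seq nat := ([:: s], [:: 0%N]).
Definition sel1 (t s a : nat) : seq nat * seq nat := ([:: t; s.+1], [:: 0%N; a]).
Definition sel2 (t s a b : nat) : seq nat * seq nat :=
  ([:: 0%N; t.+1; s.+2], [:: 0%N; a; b]).
Definition sel3 (t s : nat) : seq nat * seq nat :=
  ([:: 0%N; 1%N; t.+2; s.+3], [:: 0%N; 1%N; 2%N; 3%N]).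

(** For t = 0, after elimination of the common column, this is the Laplace expansion along one row
    of a 3 by 3 determinant in the columns 1, 2, 3. *)
Definition pl0 (t s t' s' : nat) : seq (R * (seq nat * seq nat) * (seq nat * seq nat)) :=
  [:: (1, sel1 t s 1, sel2 t' s' 2 3); (-1, sel1 t s 2, sel2 t' s' 1 3);
      (1, sel1 t s 3, sel2 t' s' 1 2)].

Definition scale (c : R) (ts : seq (R * (seq nat * seq nat) * (seq nat * seq nat))) :=
  [seq (c * t.1.1, t.1.2, t.2) | t <- ts].

Ltac pl := move=> v; rewrite /bilinear_form /= !big_cons big_nil /minor /=
  ?natdet4 ?natdet3 ?natdet2 ?natdet1 /= /bump /=; ring.

Lemma pl_00 v : bilinear_form v (pl0 0 0 0 0) = 0. Proof. move: v; pl. Qed.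
Lemma pl_10 v : bilinear_form v (pl0 0 1 0 0) = 0. Proof. move: v; pl. Qed.
Lemma pl_01 v : bilinear_form v (pl0 0 0 0 1) = 0. Proof. move: v; pl. Qed.
(** The shifts (0, 2) and (1, 1) are paired with opposite signs because the eigenvalue relations
    only involve W_2 - W_11. *)
Lemma pl_20 v : bilinear_form v (pl0 0 2 0 0 ++ scale (-1) (pl0 1 1 0 0)
  ++ [:: (-1, sel0 0, sel3 0 0)]) = 0. Proof. move: v; pl. Qed.
Lemma pl_02 v : bilinear_form v (pl0 0 0 0 2 ++ scale (-1) (pl0 0 0 1 1)
  ++ [:: (1, sel0 0, sel3 0 0)]) = 0. Proof. move: v; pl. Qed.
Lemma pl_11 v : bilinear_form v (pl0 0 1 0 1 
  ++ [:: (1, sel0 0, sel3 0 0)]) = 0. Proof. move: v; pl. Qed.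
Lemma pl_12 v : bilinear_form v (pl0 0 1 0 2 ++ scale (-1) (pl0 0 1 1 1)
  ++ [:: (1, sel0 0, sel3 0 1)]) = 0. Proof. move: v; pl. Qed.
Lemma pl_21 v : bilinear_form v (pl0 0 2 0 1 ++ scale (-1) (pl0 1 1 0 1)
  ++ [:: (-1, sel0 1, sel3 0 0)]) = 0. Proof. move: v; pl. Qed.
Lemma pl_22 v : bilinear_form v (pl0 0 2 0 2 ++ scale (-1) (pl0 0 2 1 1)
  ++ scale (-1) (pl0 1 1 0 2) ++ pl0 1 1 1 1
  ++ [:: (1, sel0 0, sel3 1 1); (-1, sel0 1, sel3 0 1); (1, sel0 2, sel3 0 0)]) = 0.
Proof. move: v; pl. Qed.
Lemma pl_bil v : bilinear_form v ([:: (2, sel1 0 0 1, sel2 1 1 2 3);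
  (-2, sel1 0 1 1, sel2 0 1 2 3);
  (2, sel1 0 2 1, sel2 0 0 2 3); (-2, sel0 0, sel3 0 0)]) = 0. Proof. move: v; pl. Qed.
End Pluecker.

(** * Wronskians with shifted rows *)

Section GeneralizedWronskian.
Variable R : comNzRingType.
Implicit Types (cs : seq (nat -> R)).

(* The columns are shifted down by two rows and preceded by two unit vectors.
   This changes no determinant, but lets rows that do not exist for small
   [size cs] be addressed; the corresponding determinants then vanish. *)
Definition ext cs (j i : nat) : R :=
  if (j < 2)%N then (i == j)%:R
  else if (i < 2)%N then 0 else nth (fun=> 0) cs (j - 2)%N (i - 2)%N.

Definition shift_rows (r t s i : nat) : nat :=
  (i + t * (i == r) + s * (i == r.+1))%N.

(** The shifts (0, 1), (0, 2) and (1, 1) give W', W_2 and W_11. *)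
Definition gwronsk (t s : nat) cs : R :=
  natdet (size cs).+2 (fun i j => ext cs j (shift_rows (size cs) t s i)).

Lemma gwronskE cs :
  gwronsk 0 0 cs = natdet (size cs) (fun i j => nth (fun=> 0) cs j i).
Proof.
have sh i : shift_rows (size cs) 0 0 i = i by rewrite /shift_rows !mul0n !addn0.
rewrite /gwronsk natdet_col_delta => [|i]; last by rewrite sh.
rewrite natdet_col_delta => [|i]; last by rewrite sh.
rewrite !sh /ext /= !mul1r; apply: eq_natdet => i j _ _.
by rewrite sh /= !subn2.
Qed.

Lemma ext_col0 cs (rho : nat -> nat) k :
  (k < 2)%N -> (forall i, (i < (size cs).+2)%N -> rho i != k) ->
  natdet (size cs).+2 (fun i j => ext cs j (rho i)) = 0.
Proof.
move=> k2 rk; apply: (@natdet_col0 _ _ _ k); first by lia.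
by move=> i hi; rewrite /ext k2 (negbTE (rk _ hi)).
Qed.

Lemma ext_dup cs (rho : nat -> nat) k l :
  (k < (size cs).+2)%N -> (l < (size cs).+2)%N -> k != l -> rho k = rho l ->
  natdet (size cs).+2 (fun i j => ext cs j (rho i)) = 0.
Proof.
move=> hk hl kl rkl; apply: (@natdet_dup _ _ _ k l) => // j _.
by rewrite rkl.
Qed.

Definition bump_row (rho : nat -> nat) (k d i : nat) : nat := (rho i + d * (i == k))%N.

Lemma sum_bump1 cs :
  \sum_(k < (size cs).+2) natdet (size cs).+2
      (fun i j => ext cs j (bump_row (shift_rows (size cs) 0 0) k 1 i)) =
  gwronsk 0 1 cs.
Proof.
rewrite big_ord_recr /= big1 ?add0r => [|k _].
  by apply: eq_natdet => i j _ _; congr ext; rewrite /bump_row /shift_rows; lia.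
apply: (@ext_dup _ _ k k.+1); rewrite /bump_row /shift_rows; have := ltn_ord k; lia.
Qed.

Lemma gwronsk11E cs : gwronsk 1 1 cs = 
  natdet (size cs).+2 (fun i j => ext cs j (bump_row (shift_rows (size cs) 0 1) (size cs) 1 i)).
Proof.
by apply: eq_natdet => i j _ _; congr ext; rewrite /bump_row /shift_rows; lia.
Qed.

Lemma sum_bump1_top cs :
  \sum_(k < (size cs).+2) natdet (size cs).+2
      (fun i j => ext cs j (bump_row (shift_rows (size cs) 0 1) k 1 i)) =
  gwronsk 0 2 cs + gwronsk 1 1 cs.
Proof.
rewrite big_ord_recr /= addrC; congr (_ + _).
  by apply: eq_natdet => i j _ _; congr ext; rewrite /bump_row /shift_rows; lia.
rewrite big_ord_recr /= gwronsk11E big1 ?add0r // => k _.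
apply: (@ext_dup _ _ k k.+1); rewrite /bump_row /shift_rows; have := ltn_ord k; lia.
Qed.

(** A row bumped by two meets an existing row unless it is one of the last two; the next-to-last one
    jumps over the last, hence the minus sign. *)
Lemma sum_bump2 cs :
  \sum_(k < (size cs).+2) natdet (size cs).+2
      (fun i j => ext cs j (bump_row (shift_rows (size cs) 0 0) k 2 i)) =
  gwronsk 0 2 cs - gwronsk 1 1 cs.
Proof.
rewrite big_ord_recr /= addrC; congr (_ + _).
  by apply: eq_natdet => i j _ _; congr ext; rewrite /bump_row /shift_rows; lia.
rewrite big_ord_recr /= big1 ?add0r => [|k _]; last first.
  have := ltn_ord k => hk.
  by apply: (@ext_dup _ _ k k.+2); rewrite /bump_row /shift_rows; lia.
rewrite /gwronsk -(@natdet_swap_rows _ _ _ (size cs) (size cs).+1) //; last by lia.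
apply: eq_natdet => i j hi hj.
by case: eqP => [->|?]; [|case: eqP => [->|?]]; congr ext;
  rewrite /bump_row /shift_rows; lia.
Qed.

(* [c2 f'' + c1 f' = l f] differentiated [i] times, when [c2] is quadratic and [c1] is linear:
   [c2], [d1], [d2] are the values of c2, c2' and c2'', [c1] and [e1] those of c1 and c1'. *)
Definition ode_jet (c2 d1 d2 c1 e1 l : R) (f : nat -> R) : Prop :=
  forall i : nat, c2 * f i.+2 + (i%:R * d1 + c1) * f i.+1
    + ('C(i, 2)%:R * d2 + i%:R * e1) * f i = l * f i.

(** The coefficient of W' is that of the last row, of derivative order [size cs] - 1, since all
    other rows bumped by one cancel; the terms of order zero add up over all rows. *)
Lemma gwronsk_ode (c2 d1 d2 c1 e1 : R) (l : nat -> R) cs :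
  (forall j, (j < size cs)%N -> ode_jet c2 d1 d2 c1 e1 (l j) (nth (fun=> 0) cs j)) ->
  (\sum_(j < size cs) l j) * gwronsk 0 0 cs =
  c2 * (gwronsk 0 2 cs - gwronsk 1 1 cs)
  + ((size cs)%:R * d1 - d1 + c1) * gwronsk 0 1 cs
  + (\sum_(i < size cs) ('C(i, 2)%:R * d2 + i%:R * e1)) * gwronsk 0 0 cs.
Proof.
move=> H; set r := size cs.
(* Row i of the extended matrix has derivative order i - 2. The subtraction is made in [R]: for
   empty [cs] the last row has order -1. *)
pose be (i : nat) : R := (i%:R - 2) * d1 + c1.
pose ga (i : nat) : R := if (i < 2)%N then 0 else ('C(i - 2, 2)%:R * d2 + (i - 2)%:R * e1).
pose B i j : R := if (i < 2)%N then 0 else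
  c2 * ext cs j i.+2 + be i * ext cs j i.+1 + ga i * ext cs j i.
pose la j : R := if (j < 2)%N then 0 else l (j - 2)%N.
have BA i j : (i < r.+2)%N -> (j < r.+2)%N -> B i j = la j * ext cs j i.
  move=> hi hj; rewrite /B /la /be /ga /ext.
  case: i hi => [|[|i]] hi; case: j hj => [|[|j]] hj //=;
    rewrite ?mul0r ?mulr0 ?addr0 // !subn2 /=.
  rewrite -H //; congr (_ + _ * _ + _).
  by rewrite -[i.+2]addn2 natrD addrK.
have := natdet_sum_rows BA; rewrite -/r => E.
have -> : gwronsk 0 0 cs = natdet r.+2 (fun i j => ext cs j i).
  by apply: eq_natdet => i j _ _; congr ext; rewrite /shift_rows; lia.
have -> : \sum_(j < r) l j = \sum_(j < r.+2) la j.
  rewrite !big_ord_recl /la /= !add0r; apply: eq_bigr => j _.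
  by congr l; rewrite /bump /=; lia.
rewrite E.
have Ek (k : 'I_r.+2) : natdet r.+2 (fun i j => if i == k :> nat then B k j else ext cs j i)
  = c2 * natdet r.+2 (fun i j => ext cs j (bump_row (shift_rows r 0 0) k 2 i))
   + be k * natdet r.+2 (fun i j => ext cs j (bump_row (shift_rows r 0 0) k 1 i))
   + ga k * natdet r.+2 (fun i j => ext cs j i).
  have bz d : (0 < d)%N -> (k < 2)%N ->
      natdet r.+2 (fun i j => ext cs j (bump_row (shift_rows r 0 0) k d i)) = 0.
    by move=> hd hk; apply: (@ext_col0 _ _ k) => // i hi; rewrite /bump_row /shift_rows; lia.
  have [k2|k2] := ltnP k 2.
    rewrite !bz // /ga k2 !mulr0 mul0r !addr0.
    by apply: (@natdet_row0 _ _ _ k) => // j _; rewrite eqxx /B k2.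
  have rr (d : nat) : natdet r.+2 (fun i j => ext cs j (bump_row (shift_rows r 0 0) k d i)) =
      natdet r.+2 (fun i j => if i == k :> nat then ext cs j (d + k)%N else ext cs j i).
    apply: eq_natdet => i j _ _; case: eqP => [->|ik]; congr ext; rewrite /bump_row /shift_rows; lia.
  have -> : natdet r.+2 (fun i j => ext cs j i) =
      natdet r.+2 (fun i j => if i == k :> nat then ext cs j k else ext cs j i).
    by apply: eq_natdet => i j _ _; case: eqP => [->|].
  rewrite !rr !natdet_row_expand !mulr_sumr -!big_split /=; apply: eq_bigr => j _.
  rewrite /B ltnNge k2 /=; ring.
rewrite (eq_bigr _ (fun k _ => Ek k)) 2!big_split; congr (_ + _ + _).
- by rewrite -mulr_sumr sum_bump2.
- rewrite -sum_bump1 -/r mulr_sumr; apply: eq_bigr => k _.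
  have [kr|kr] := eqVneq (k : nat) r.+1.
    by congr (_ * _); rewrite /be kr -[r.+1%:R]natr1; ring.
  rewrite (_ : natdet _ _ = 0) ?mulr0 //.
  by apply: (@ext_dup _ _ k k.+1); rewrite /bump_row /shift_rows; have := ltn_ord k; lia.
rewrite -mulr_suml; congr (_ * _); rewrite !big_ord_recl /ga /= !add0r.
by apply: eq_bigr => i _; rewrite /bump /= !add1n subn2.
Qed.

End GeneralizedWronskian.

(** * Pluecker relations for shifted Wronskians *)

Section PlueckerWronskian.
Variable R : numFieldType.
Variables (F : seq (nat -> R)) (a b c : nat -> R).
(** [ext] puts two unit columns before [F], which makes [size F] + 2 common columns. One of them is
    the common column of the base relations, the others come from lifting. *)
Let m := (size F).+1.
Let v := ext (F ++ [:: a; b; c]).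

(** The base selections have one common column where [shift_rows] counts two, hence the offsets by
    1. For empty [l] the next-to-last row is a common row and cannot be shifted, so t must be 0. *)
Lemma minor_gwronsk (t s : nat) (rows l : seq nat) :
  size rows = (size l).+1 -> all (fun k => 0 < k < 4)%N l ->
  (l == [::]) ==> (t == 0%N) ->
  (forall i, (i < (size l).+1)%N ->
     nth 0%N rows i = shift_rows (size l) (t * (l != [::])) s i.+1 - 1)%N ->
  minor v (iter m (@lift_minor) (rows, 0%N :: l)) =
  gwronsk t s (F ++ [seq nth (fun=> 0) [:: a; b; c] k.-1 | k <- l]).
Proof.
move=> sr al tl nr; rewrite minor_iter_lift /fst /snd sr /gwronsk size_cat size_map.
have -> : (m + (size l).+1 = (size F + size l).+2)%N by rewrite /m; lia.
apply: eq_natdet => i j hi hj.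
rewrite !nth_iter_lift_idx ?sr; try by rewrite /m /=; lia.
have -> : (if i < m then i else nth 0 rows (i - m) + m)%N =
    shift_rows (size F + size l) t s i.
  case: ltnP => im.
    rewrite /shift_rows; rewrite /m in im hi.
    by case: l tl {sr al nr hi hj} => [/eqP ->|k l _] /=; lia.
  rewrite nr; last by rewrite /m in im *; lia.
  rewrite /shift_rows; rewrite /m in im hi *.
  by case: l tl {sr al nr hi hj} => [/eqP ->|k l _] /=; lia.
rewrite /v; set k := shift_rows _ _ _ _; move: k => k; rewrite /m /ext.
have [j2|j2] := ltnP j 2.
  have -> : (if j < (size F).+1 then j
    else nth 0 (0 :: l) (j - (size F).+1) + (size F).+1)%N = j; last by rewrite j2.
  case: ltnP => // jF; have -> : (j - (size F).+1 = 0)%N by lia.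
  by rewrite /=; lia.
have [jF|jF] := ltnP (j - 2) (size F).
  have -> : (if j < (size F).+1 then j
    else nth 0 (0 :: l) (j - (size F).+1) + (size F).+1)%N = j.
    case: ltnP => // jF'; have -> : (j - (size F).+1 = 0)%N by lia.
    by rewrite /=; lia.
  by rewrite ltnNge j2 /= !nth_cat jF.
rewrite ltnNge (_ : (j < (size F).+1)%N = false); last by lia.
have -> : (j - (size F).+1 = (j - 2 - size F).+1)%N by lia.
rewrite /=; set J := (j - 2 - size F)%N.
have hJ : (J < size l)%N by rewrite /J; lia.
have /andP[l0 l4] : (0 < nth 0%N l J < 4)%N := allP al _ (mem_nth 0%N hJ).
rewrite ifF; last by lia.
case: ifP => // _; rewrite !nth_cat.
rewrite ifF; last by lia.
rewrite ifF; last by lia.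
have -> : (nth 0%N l J + (size F).+1 - 2 - size F = (nth 0%N l J).-1)%N by lia.
by rewrite (nth_map 0%N).
Qed.

Local Notation x t s u := (gwronsk t s (F ++ [:: u])).
Local Notation y t s u u' := (gwronsk t s (F ++ [:: u; u'])).
Local Notation w t s := (gwronsk t s (F ++ [:: a; b; c])).
Local Notation tau s := (gwronsk 0 s F).

Lemma minor_sel0 s : minor v (iter m (@lift_minor) (sel0 s)) = tau s.
Proof.
rewrite (@minor_gwronsk 0 s [:: s] [::]) ?cats0 // => -[|i] //= _.
by rewrite /shift_rows /=; lia.
Qed.

Lemma minor_sel1 t s (k : nat) : (0 < k < 4)%N ->
  minor v (iter m (@lift_minor) (sel1 t s k)) = x t s (nth (fun=> 0) [:: a; b; c] k.-1).
Proof.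
move=> k4; rewrite (@minor_gwronsk t s _ [:: k]) //= ?k4 // => -[|[|i]] //= _;
rewrite /shift_rows /=; lia.
Qed.

Lemma minor_sel2 t s (k l : nat) : (0 < k < 4)%N -> (0 < l < 4)%N ->
  minor v (iter m (@lift_minor) (sel2 t s k l)) =
  y t s (nth (fun=> 0) [:: a; b; c] k.-1) (nth (fun=> 0) [:: a; b; c] l.-1).
Proof.
move=> k4 l4; rewrite (@minor_gwronsk t s _ [:: k; l]) //= ?k4 ?l4 // => -[|[|[|i]]] //= _;
rewrite /shift_rows /=; lia.
Qed.

Lemma minor_sel3 t s : minor v (iter m (@lift_minor) (sel3 t s)) = w t s.
Proof.
rewrite (@minor_gwronsk t s _ [:: 1; 2; 3]%N) //= => -[|[|[|[|i]]]] //= _;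
rewrite /shift_rows /=; lia.
Qed.

Ltac use_pl pl := 
  have := bilinear_form_lifts m pl isT v;
  rewrite /bilinear_form /= !big_cons big_nil !iter_lift_term /=
    ?minor_sel0 ?minor_sel3 ?minor_sel1 // ?minor_sel2 //=.

Definition cyc t s t' s' :=
  x t s a * y t' s' b c - x t s b * y t' s' a c + x t s c * y t' s' a b.

Lemma cyc_00 : cyc 0 0 0 0 = 0.
Proof. use_pl (@pl_00 R) => e; rewrite -e /cyc; ring. Qed.
Lemma cyc_10 : cyc 0 1 0 0 = 0.
Proof. use_pl (@pl_10 R) => e; rewrite -e /cyc; ring. Qed.
Lemma cyc_01 : cyc 0 0 0 1 = 0.
Proof. use_pl (@pl_01 R) => e; rewrite -e /cyc; ring. Qed.
Lemma cyc_20 : cyc 0 2 0 0 - cyc 1 1 0 0 = tau 0 * w 0 0.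
Proof. use_pl (@pl_20 R) => e; apply/eqP; rewrite -subr_eq0 -e /cyc; apply/eqP; ring. Qed.
Lemma cyc_02 : cyc 0 0 0 2 - cyc 0 0 1 1 = - (tau 0 * w 0 0).
Proof. use_pl (@pl_02 R) => e; apply/eqP; rewrite -subr_eq0 -e /cyc; apply/eqP; ring. Qed.
Lemma cyc_11 : cyc 0 1 0 1 = - (tau 0 * w 0 0).
Proof. use_pl (@pl_11 R) => e; apply/eqP; rewrite -subr_eq0 -e /cyc; apply/eqP; ring. Qed.
Lemma cyc_12 : cyc 0 1 0 2 - cyc 0 1 1 1 = - (tau 0 * w 0 1).
Proof. use_pl (@pl_12 R) => e; apply/eqP; rewrite -subr_eq0 -e /cyc; apply/eqP; ring. Qed.
Lemma cyc_21 : cyc 0 2 0 1 - cyc 1 1 0 1 = tau 1 * w 0 0.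
Proof. use_pl (@pl_21 R) => e; apply/eqP; rewrite -subr_eq0 -e /cyc; apply/eqP; ring. Qed.
Lemma cyc_22 : cyc 0 2 0 2 - cyc 0 2 1 1 - cyc 1 1 0 2 + cyc 1 1 1 1 =
  - (tau 0 * w 1 1 - tau 1 * w 0 1 + tau 2 * w 0 0).
Proof. use_pl (@pl_22 R) => e; apply/eqP; rewrite -subr_eq0 -e /cyc; apply/eqP; ring. Qed.
(** Here the rows vary and the columns stay: modulo [F] this is the Laplace expansion of a 3 by 3
    determinant along the column of [a], the three rows being distributed in complementary ways. *)
Lemma hirota : x 0 0 a * y 1 1 b c - x 0 1 a * y 0 1 b c + x 0 2 a * y 0 0 b c
  = tau 0 * w 0 0.
Proof.
use_pl (@pl_bil R) => e.
have : 2 * (x 0 0 a * y 1 1 b c - x 0 1 a * y 0 1 b c + x 0 2 a * y 0 0 b c - tau 0 * w 0 0) = 0.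
  by rewrite -e; ring.
by move/eqP; rewrite mulf_eq0 pnatr_eq0 subr_eq0 /= => /eqP.
Qed.

End PlueckerWronskian.

(** * Bilinear identities at a point *)

Section LocalIdentities.
Variable R : numFieldType.
Variables (c2 d1 d2 c1 e1 : R) (F : seq (nat -> R)) (lF : nat -> R).
Variables (a b c : nat -> R) (la lb lc : R).
Local Notation ode := (ode_jet c2 d1 d2 c1 e1).
Hypothesis odeF : forall j, (j < size F)%N -> ode (lF j) (nth (fun=> 0) F j).
Hypotheses (odea : ode la a) (odeb : ode lb b) (odec : ode lc c).

Let n := size F.
Let K m : R := \sum_(i < m) ('C(i, 2)%:R * d2 + i%:R * e1).

Local Notation x t s u := (gwronsk t s (F ++ [:: u])).
Local Notation y t s u u' := (gwronsk t s (F ++ [:: u; u'])).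
Local Notation w t s := (gwronsk t s (F ++ [:: a; b; c])).
Local Notation tau t s := (gwronsk t s F).

Lemma gwronsk_ode_cat (us : seq (nat -> R)) (ls : seq R) :
  size us = size ls ->
  (forall j, (j < size us)%N -> ode (nth 0 ls j) (nth (fun=> 0) us j)) ->
  (\sum_(j < n) lF j + \sum_(l <- ls) l) * gwronsk 0 0 (F ++ us) =
  c2 * (gwronsk 0 2 (F ++ us) - gwronsk 1 1 (F ++ us))
  + ((n + size us)%:R * d1 - d1 + c1) * gwronsk 0 1 (F ++ us)
  + K (n + size us) * gwronsk 0 0 (F ++ us).
Proof.
move=> sul H; rewrite -size_cat.
rewrite -(@gwronsk_ode _ c2 d1 d2 c1 e1 
  (fun j => if (j < n)%N then lF j else nth 0 ls (j - n)%N)); last first.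
  move=> j; rewrite size_cat nth_cat -/n; have [jn _|nj h] := ltnP j n; first exact: odeF.
  by apply: H; rewrite ltn_subLR.
congr (_ * _); rewrite size_cat big_split_ord /=; congr (_ + _).
  by apply: eq_bigr => j _; rewrite ltn_ord.
rewrite (big_nth 0) big_mkord sul; apply: eq_bigr => j _.
by rewrite ifF ?addKn //; lia.
Qed.

Let KS m : K m.+1 = K m + ('C(m, 2)%:R * d2 + m%:R * e1).
Proof. by rewrite /K big_ord_recr. Qed.

Let ode0 := @gwronsk_ode_cat [::] [::] erefl (fun j h => False_ind _ (notF h)).

Let ode1 u l : ode l u -> _ := fun h => @gwronsk_ode_cat [:: u] [:: l] erefl
  (fun j => match j with 0%N => fun=> h | _.+1 => fun h => False_ind _ (notF h) end).

Let ode2 u l u' l' : ode l u -> ode l' u' -> _ := fun h h' =>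
 @gwronsk_ode_cat [:: u; u'] [:: l; l'] erefl
  (fun j => match j with 0%N => fun=> h | 1%N => fun=> h'
   | _.+2 => fun h => False_ind _ (notF h) end).

Let ode3 := @gwronsk_ode_cat [:: a; b; c] [:: la; lb; lc] erefl
  (fun j => match j with 0%N => fun=> odea | 1%N => fun=> odeb | 2 => fun=> odec
   | _.+3 => fun h => False_ind _ (notF h) end).

(* Combining [gwronsk_ode] for the Wronskians of F b, F c, F a b and F a c, each
   multiplied by its complement in a Pluecker relation, all shifted rows recombine. *)
Lemma exchange_identity :
  c2 * (x 0 0 a * (y 0 2 b c + y 1 1 b c) - 2 * x 0 1 a * y 0 1 b c
        + (x 0 2 a + x 1 1 a) * y 0 0 b c)
  + (n.+1%:R * d1 + c1) * (x 0 0 a * y 0 1 b c)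
  - (n%:R * d1 + c1) * (x 0 1 a * y 0 0 b c)
  + ('C(n.+1, 2)%:R * d2 + n.+1%:R * e1) * (x 0 0 a * y 0 0 b c)
  = (la + lb - lc) * (x 0 0 a * y 0 0 b c) + 2 * (lc - lb) * (x 0 0 b * y 0 0 a c).
Proof.
have E1 := ode1 odeb; have E2 := ode1 odec.
have E3 := ode2 odea odec; have E4 := ode2 odea odeb.
rewrite !big_cons big_nil !addr0 /= !addn1 in E1 E2.
rewrite !big_cons big_nil !addr0 /= !addn2 KS -[n.+2%:R]natr1 in E3 E4.
rewrite -[n.+1%:R]natr1 in E1 E2.
have P00 := cyc_00 F a b c; have P01 := cyc_01 F a b c; have P10 := cyc_10 F a b c.
have P20 := cyc_20 F a b c; have P02 := cyc_02 F a b c; have PH := hirota F a b c.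
rewrite /cyc in P00 P01 P10 P20 P02.
set L := \sum_(j < n) lF j in E1 E2 E3 E4.
apply/eqP; rewrite -subr_eq0; apply/eqP.
set xa := x 0 0 a; set xb := x 0 0 b; set xc := x 0 0 c.
move: E1 E2 E3 E4 P00 P01 P10 P20 P02 PH; rewrite -/xa -/xb -/xc.
set xa1 := x 0 1 a; set xb1 := x 0 1 b; set xc1 := x 0 1 c.
set xa2 := x 0 2 a; set xb2 := x 0 2 b; set xc2 := x 0 2 c.
set xa11 := x 1 1 a; set xb11 := x 1 1 b; set xc11 := x 1 1 c.
set ybc := y 0 0 b c; set yac := y 0 0 a c; set yab := y 0 0 a b.
set ybc1 := y 0 1 b c; set yac1 := y 0 1 a c; set yab1 := y 0 1 a b.
set ybc2 := y 0 2 b c; set yac2 := y 0 2 a c; set yab2 := y 0 2 a b.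
set ybc11 := y 1 1 b c; set yac11 := y 1 1 a c; set yab11 := y 1 1 a b.
set tw := _ * w 0 0.
move=> E1 E2 E3 E4 P00 P01 P10 P20 P02 PH.
set k := 'C(n.+1, 2)%:R * d2 + _ in E3 E4 *.
set nn := n%:R in E1 E2 E3 E4 *; rewrite -[n.+1%:R]natr1 -/nn.
set KK := K n.+1 in E1 E2 E3 E4.
(* The c2 part is twice [hirota] plus the difference of the relations [P02] and [P20]. This turns
   W_2 - W_11 into W_2 + W_11 in both factors, and the copies of [tw] cancel as - 2 + 1 + 1. *)
transitivity (
  - (xb * ((L + (la + lc)) * yac
        - (c2 * (yac2 - yac11) + ((n.+1%:R + 1) * d1 - d1 + c1) * yac1 + (KK + k) * yac))
   - yac * ((L + lb) * xb
        - (c2 * (xb2 - xb11) + ((nn + 1) * d1 - d1 + c1) * xb1 + KK * xb))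
   - xc * ((L + (la + lb)) * yab
        - (c2 * (yab2 - yab11) + ((n.+1%:R + 1) * d1 - d1 + c1) * yab1 + (KK + k) * yab))
   + yab * ((L + lc) * xc
        - (c2 * (xc2 - xc11) + ((nn + 1) * d1 - d1 + c1) * xc1 + KK * xc)))
  + (k - (la + lb - lc)) * (xa * ybc - xb * yac + xc * yab)
  + ((nn + 1) * d1 + c1) * (xa * ybc1 - xb * yac1 + xc * yab1)
  - (nn * d1 + c1) * (xa1 * ybc - xb1 * yac + xc1 * yab)
  + c2 * (2 * ((xa * ybc11 - xa1 * ybc1 + xa2 * ybc) - tw)
     + ((xa * ybc2 - xb * yac2 + xc * yab2 - (xa * ybc11 - xb * yac11 + xc * yab11)) + tw)
     - ((xa2 * ybc - xb2 * yac + xc2 * yab - (xa11 * ybc - xb11 * yac + xc11 * yab)) - tw))).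
  by rewrite -[n.+1%:R]natr1 -/nn; clearbody L xa xb xc xa1 xb1 xc1 xa2 xb2 xc2
    xa11 xb11 xc11 ybc yac yab ybc1 yac1 yab1 ybc2 yac2 yab2 ybc11 yac11 yab11 tw k nn KK; ring.
rewrite E1 E2 E3 E4 P00 P01 P10 P20 P02 PH; ring.
Qed.

(* Multiplying [gwronsk_ode] for F u with [gwronsk_ode] for F v w and summing cyclically
   produces the weights [l_u * (l_v + l_w)]. *)
Lemma removal_identity :
  c2 ^+ 2 * (tau 0 0 * (w 0 2 + w 1 1) - 2 * tau 0 1 * w 0 1
             + (tau 0 2 + tau 1 1) * w 0 0)
  + c2 * (((3 * n%:R + 2) * d1 + 3 * c1) * (tau 0 0 * w 0 1)
        - ((3 * n%:R + 1) * d1 + 3 * c1) * (tau 0 1 * w 0 0))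
  + (2 * (n%:R * d1 + c1) * ((n%:R + 1) * d1 + c1)
     + c2 * (('C(n, 2)%:R + n%:R + 1) * d2 + (n%:R + 1) * e1)) * (tau 0 0 * w 0 0)
  = 2 * (lc - la) * (lc - lb) * (x 0 0 c * y 0 0 a b)
    + (la + lb - lc) * c2 * (tau 0 0 * w 0 0).
Proof.
have E1 := ode1 odea; have E2 := ode1 odeb; have E3 := ode1 odec.
have E4 := ode2 odeb odec; have E5 := ode2 odea odec; have E6 := ode2 odea odeb.
have E7 := ode0; have E8 := ode3.
rewrite !big_cons big_nil !addr0 /= !addn1 in E1 E2 E3.
rewrite !big_cons big_nil !addr0 /= !addn2 KS -[n.+2%:R]natr1 in E4 E5 E6.
rewrite big_nil addr0 cats0 addn0 in E7.
rewrite !big_cons big_nil !addr0 /= !addn3 !KS -[n.+3%:R]natr1 -[n.+2%:R]natr1 in E8.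
rewrite !binS !bin0 !bin1 !addnA !natrD in E4 E5 E6 E8.
rewrite KS in E1 E2 E3 E4 E5 E6.
have P00 := cyc_00 F a b c; have P01 := cyc_01 F a b c; have P10 := cyc_10 F a b c.
have P20 := cyc_20 F a b c; have P02 := cyc_02 F a b c; have P11 := cyc_11 F a b c.
have P12 := cyc_12 F a b c; have P21 := cyc_21 F a b c; have P22 := cyc_22 F a b c.
rewrite /cyc in P00 P01 P10 P20 P02 P11 P12 P21 P22.
rewrite -[n.+1%:R]natr1 in E1 E2 E3 E4 E5 E6 E8.
set L := \sum_(j < n) lF j in E1 E2 E3 E4 E5 E6 E7 E8.
set k := K n in E1 E2 E3 E4 E5 E6 E7 E8.
set B := 'C(n, 2)%:R in E1 E2 E3 E4 E5 E6 E7 E8 *.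
set nn := n%:R in E1 E2 E3 E4 E5 E6 E7 E8 *.
move: P00 P01 P10 P20 P02 P11 P12 P21 P22 E1 E2 E3 E4 E5 E6 E7 E8.
set xa := x 0 0 a; set xb := x 0 0 b; set xc := x 0 0 c.
set xa1 := x 0 1 a; set xb1 := x 0 1 b; set xc1 := x 0 1 c.
set xa2 := x 0 2 a; set xb2 := x 0 2 b; set xc2 := x 0 2 c.
set xa11 := x 1 1 a; set xb11 := x 1 1 b; set xc11 := x 1 1 c.
set ybc := y 0 0 b c; set yac := y 0 0 a c; set yab := y 0 0 a b.
set ybc1 := y 0 1 b c; set yac1 := y 0 1 a c; set yab1 := y 0 1 a b.
set ybc2 := y 0 2 b c; set yac2 := y 0 2 a c; set yab2 := y 0 2 a b.
set ybc11 := y 1 1 b c; set yac11 := y 1 1 a c; set yab11 := y 1 1 a b.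
set w0 := w 0 0; set w1 := w 0 1; set w2 := w 0 2; set w11 := w 1 1.
set t0 := tau 0 0; set t1 := tau 0 1; set t2 := tau 0 2; set t11 := tau 1 1.
clearbody L xa xb xc xa1 xb1 xc1 xa2 xb2 xc2
    xa11 xb11 xc11 ybc yac yab ybc1 yac1 yab1 ybc2 yac2 yab2 ybc11 yac11 yab11
    w0 w1 w2 w11 t0 t1 t2 t11 k B nn.
move=> P00 P01 P10 P20 P02 P11 P12 P21 P22 E1 E2 E3 E4 E5 E6 E7 E8.
pose k1 := k + (B * d2 + nn * e1).
pose k2 := k1 + ((B + nn) * d2 + (nn + 1) * e1).
pose be1 := nn * d1 + c1; pose be2 := (nn + 1) * d1 + c1.
(* [P00], [V] and [Z] weigh the three products by 1, l_u and l_u (l_v + l_w) = e l_u - l_u^2, where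
   e = la + lb + lc. Solving this Vandermonde system for [xc * yab] produces the factor
   [(lc - la) * (lc - lb)]. *)
have V : la * (xa * ybc) - lb * (xb * yac) + lc * (xc * yab) = c2 * (t0 * w0).
  transitivity ((L + la) * xa * ybc - (L + lb) * xb * yac + (L + lc) * xc * yab
    - L * (xa * ybc - xb * yac + xc * yab)); first by ring.
  rewrite E1 E2 E3 P00 -P20; transitivity (c2 *
    (xa2 * ybc - xb2 * yac + xc2 * yab - (xa11 * ybc - xb11 * yac + xc11 * yab)) +
    be1 * (xa1 * ybc - xb1 * yac + xc1 * yab)
    + k1 * (xa * ybc - xb * yac + xc * yab)); first by rewrite /be1 /k1; ring.
  by rewrite P10 P00; ring.
have Z : la * (lb + lc) * (xa * ybc) - lb * (la + lc) * (xb * yac)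
    + lc * (la + lb) * (xc * yab) =
  - c2 ^+ 2 * (t0 * w11 - t1 * w1 + t2 * w0) + c2 * (be2 * (t1 * w0) - be1 * (t0 * w1))
  - be1 * be2 * (t0 * w0) + (k2 - k1) * c2 * (t0 * w0).
  transitivity (((L + la) * xa) * ((L + (lb + lc)) * ybc)
      - ((L + lb) * xb) * ((L + (la + lc)) * yac)
      + ((L + lc) * xc) * ((L + (la + lb)) * yab)
      - L * (L + la + lb + lc) * (xa * ybc - xb * yac + xc * yab)); first by ring.
  rewrite E1 E2 E3 E4 E5 E6 P00.
  transitivity (c2 ^+ 2 * (xa2 * ybc2 - xb2 * yac2 + xc2 * yab2 -
      (xa2 * ybc11 - xb2 * yac11 + xc2 * yab11) -
      (xa11 * ybc2 - xb11 * yac2 + xc11 * yab2) +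
      (xa11 * ybc11 - xb11 * yac11 + xc11 * yab11))
    + c2 * be2 * (xa2 * ybc1 - xb2 * yac1 + xc2 * yab1 -
        (xa11 * ybc1 - xb11 * yac1 + xc11 * yab1))
    + c2 * be1 * (xa1 * ybc2 - xb1 * yac2 + xc1 * yab2 -
        (xa1 * ybc11 - xb1 * yac11 + xc1 * yab11))
    + be1 * be2 * (xa1 * ybc1 - xb1 * yac1 + xc1 * yab1)
    + k2 * (c2 * (xa2 * ybc - xb2 * yac + xc2 * yab -
         (xa11 * ybc - xb11 * yac + xc11 * yab))
       + be1 * (xa1 * ybc - xb1 * yac + xc1 * yab))
    + k1 * (c2 * (xa * ybc2 - xb * yac2 + xc * yab2 -
         (xa * ybc11 - xb * yac11 + xc * yab11))
       + be2 * (xa * ybc1 - xb * yac1 + xc * yab1))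
    + k1 * k2 * (xa * ybc - xb * yac + xc * yab)).
    by rewrite /k2 /k1 /be1 /be2; ring.
  by rewrite P22 P21 P12 P11 P20 P10 P02 P01 P00; ring.
(* [Z] contains only [w11] and [t2] of the two second derivatives; [T], in which [L] cancels, adds
   [w2 - w11] and [t2 - t11] with the signs that complete both sums. *)
have T : (la + lb + lc) * (t0 * w0) =
    c2 * (t0 * (w2 - w11) - (t2 - t11) * w0)
    + ((nn + 2) * d1 + c1) * (t0 * w1) - (nn * d1 - d1 + c1) * (t1 * w0)
    + (k2 + ((B + nn + nn + 1) * d2 + (nn + 2) * e1) - k) * (t0 * w0).
  transitivity (t0 * ((L + (la + (lb + lc))) * w0) - L * t0 * w0); first by ring.
  by rewrite E8 E7 /k2 /k1; ring.
transitivity (- 2 * (la * (lb + lc) * (xa * ybc) - lb * (la + lc) * (xb * yac)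
    + lc * (la + lb) * (xc * yab)) + c2 * ((la + lb + lc) * (t0 * w0))).
  by rewrite Z T /k2 /k1 /be1 /be2; ring.
transitivity (2 * (lc - la) * (lc - lb) * (xc * yab) + (la + lb - lc) * (c2 * (t0 * w0))
   - 2 * (la * lb) * (xa * ybc - xb * yac + xc * yab)); last by rewrite P00; ring.
transitivity (- 2 * (la * (lb + lc) * (xa * ybc) - lb * (la + lc) * (xb * yac)
    + lc * (la + lb) * (xc * yab)) + 2 * lc * (c2 * (t0 * w0))
    + (la + lb - lc) * (c2 * (t0 * w0))); first by ring.
by rewrite -V; ring.
Qed.

End LocalIdentities.

(** * Derivatives of Wronskians *)

Section RealDerivatives.
Variable R : realType.
Implicit Types (f g : R -> R) (x : R).

Lemma is_derive_add f g x df dg : is_derive x 1 f df -> is_derive x 1 g dg ->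
  is_derive x 1 (fun y => f y + g y) (df + dg).
Proof. exact: is_deriveD. Qed.

Lemma is_derive_mul f g x df dg : is_derive x 1 f df -> is_derive x 1 g dg ->
  is_derive x 1 (fun y => f y * g y) (df * g x + f x * dg).
Proof.
move=> hf hg; have h := is_deriveM hf hg; apply: (is_derive_eq h).
by rewrite /GRing.scale /=; ring.
Qed.

Lemma is_derive_const (a x : R) : is_derive x 1 (fun=> a) 0.
Proof. exact: is_derive_cst. Qed.

Lemma is_derive_bigsum (I : Type) (r : seq I) (f : I -> R -> R) (df : I -> R) x :
  (forall i, is_derive x 1 (f i) (df i)) ->
  is_derive x 1 (fun y => \sum_(i <- r) f i y) (\sum_(i <- r) df i).
Proof.
move=> H; elim: r => [|i r IH].
  under eq_fun do rewrite big_nil; rewrite big_nil; exact: is_derive_const.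
under eq_fun do rewrite big_cons; rewrite big_cons; exact: is_derive_add.
Qed.

Lemma is_derive_bigprod (I : eqType) (r : seq I) (f : I -> R -> R) (df : I -> R) x :
  uniq r -> (forall i, is_derive x 1 (f i) (df i)) ->
  is_derive x 1 (fun y => \prod_(i <- r) f i y)
    (\sum_(k <- r) \prod_(i <- r) (if i == k then df i else f i x)).
Proof.
move=> + H; elim: r => [_|i r IH /= /andP[ir ur]].
  under eq_fun do rewrite big_nil; rewrite big_nil; exact: is_derive_const.
under eq_fun do rewrite big_cons; rewrite big_cons /=.
apply: is_derive_eq; first by apply: is_derive_mul (H i) (IH ur).
rewrite big_cons eqxx; congr (_ * _ + _).
  rewrite !big_seq; apply: eq_bigr => j jr.
  by rewrite ifN //; apply: contraNneq ir => <-.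
rewrite mulr_sumr !big_seq; apply: eq_bigr => j jr.
by rewrite big_cons ifN //; apply: contraNneq ir => ->.
Qed.

Lemma is_derive_natdet n (A : R -> nat -> nat -> R) (dA : nat -> nat -> R) x :
  (forall i j, is_derive x 1 (fun y => A y i j) (dA i j)) ->
  is_derive x 1 (fun y => natdet n (A y))
    (\sum_(k < n) natdet n (fun i j => if i == k :> nat then dA i j else A x i j)).
Proof.
move=> H; rewrite /natdet /determinant exchange_big /=.
apply: is_derive_bigsum => s; rewrite -mulr_sumr.
apply: is_derive_eq; first apply: is_derive_mul (is_derive_const _ _) _.
  under eq_fun do under eq_bigr do rewrite mxE.
  apply: (@is_derive_bigprod _ _ (fun (i : 'I_n) y => A y i (s i))
    (fun i => dA i (s i))) => //; exact: index_enum_uniq.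
rewrite mul0r add0r; congr (_ * _); apply: eq_bigr => k _.
by apply: eq_bigr => i _; rewrite mxE val_eqE.
Qed.

Definition jet_at (u : R -> nat -> R) x :=
  forall i, is_derive x 1 (fun y => u y i) (u x i.+1).

Lemma is_derive_gwronsk (t s : nat) (us : seq (R -> nat -> R)) x : (t <= s)%N ->
  (forall j, (j < size us)%N -> jet_at (nth (fun _ _ => 0) us j) x) ->
  is_derive x 1 (fun y => gwronsk t s [seq u y | u <- us])
    (\sum_(k < (size us).+2) natdet (size us).+2 (fun i j =>
       ext [seq u x | u <- us] j (bump_row (shift_rows (size us) t s) k 1 i))).
Proof.
move=> ts H; rewrite /gwronsk; under eq_fun do rewrite size_map.
set rho := shift_rows _ _ _.
pose e y := ext [seq u y | u <- us].
pose de i j := if (rho i < 2)%N then 0 else e x j (rho i).+1.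
have De i j : is_derive x 1 (fun y => e y j (rho i)) (de i j).
  have [r2|r2] := ltnP (rho i) 2.
    rewrite /de /e /ext r2; case: ifP => _; exact: is_derive_const.
  have r0 : (rho i < 2)%N = false by lia.
  have r1 : ((rho i).+1 < 2)%N = false by lia.
  rewrite /de /e /ext r0 r1.
  have [j2|j2] := ltnP j 2.
    rewrite (_ : (_.+1 == j) = false); last by lia.
    exact: is_derive_const.
  have [jn|nj] := ltnP (j - 2) (size us); last first.
    rewrite nth_default ?size_map //.
    under eq_fun do rewrite nth_default ?size_map //.
    exact: is_derive_const.
  rewrite (nth_map (fun _ _ => 0)) // (_ : ((rho i).+1 - 2 = (rho i - 2).+1)%N); last by lia.
  under eq_fun do rewrite (nth_map (fun _ _ => 0)) //.
  exact: H.
apply: is_derive_eq; first exact: (is_derive_natdet _ De).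
apply: eq_bigr => -[k kn] _ /=; have [rk|rk] := ltnP (rho k) 2; last first.
  apply: eq_natdet => i j _ _; rewrite /bump_row /de.
  case: eqP => [->|ik]; last by rewrite muln0 addn0.
  by rewrite ltnNge rk /= muln1 addn1.
(* A unit row has derivative 0, and bumping it leaves its unit column empty: by [t <= s] no other
   shifted row has the same index. *)
rewrite (natdet_row0 kn) => [|j _]; last by rewrite eqxx /de rk.
have hs : size [seq u x | u <- us] = size us by rewrite size_map.
rewrite -hs (@ext_col0 _ _ _ (rho k)) // => i hi.
by move: rk; rewrite /bump_row /rho /shift_rows; lia.
Qed.

Lemma is_derive_gwronsk00 (us : seq (R -> nat -> R)) x :
  (forall j, (j < size us)%N -> jet_at (nth (fun _ _ => 0) us j) x) ->
  is_derive x 1 (fun y => gwronsk 0 0 [seq u y | u <- us])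
    (gwronsk 0 1 [seq u x | u <- us]).
Proof.
move=> H; apply: is_derive_eq; first exact: is_derive_gwronsk.
by rewrite -sum_bump1 size_map.
Qed.

Lemma is_derive_gwronsk01 (us : seq (R -> nat -> R)) x :
  (forall j, (j < size us)%N -> jet_at (nth (fun _ _ => 0) us j) x) ->
  is_derive x 1 (fun y => gwronsk 0 1 [seq u y | u <- us])
    (gwronsk 0 2 [seq u x | u <- us] + gwronsk 1 1 [seq u x | u <- us]).
Proof.
move=> H; apply: is_derive_eq; first exact: is_derive_gwronsk.
by rewrite -sum_bump1_top size_map.
Qed.

End RealDerivatives.

(** * Laguerre and Jacobi equations *)

Section ClassicalEquations.
Variable R : realType.

Lemma pochhammerS (a : R) k : pochhammer a k.+1 = a * pochhammer (a + 1) k.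
Proof.
rewrite /pochhammer big_ord_recl addr0; congr (_ * _); apply: eq_bigr => i _.
by rewrite /= /bump add1n -natr1; ring.
Qed.

Lemma pochhammerSr (a : R) k : pochhammer a k.+1 = pochhammer a k * (a + k%:R).
Proof. by rewrite /pochhammer big_ord_recr. Qed.

Lemma natr_fact_neq0 k : k`!%:R != 0 :> R.
Proof. by rewrite pnatr_eq0 -lt0n fact_gt0. Qed.

Lemma laguerre_coef_rec n (a : R) k :
  k.+1%:R * (k%:R + a + 1) * (laguerre n a)`_k.+1 = (k%:R - n%:R) * (laguerre n a)`_k.
Proof.
have -> : laguerre n a = \poly_(k < n.+1)
    ((-1) ^+ k * pochhammer (a + k%:R + 1) (n - k) / (k`! * (n - k)`!)%:R).
  by rewrite poly_def.
rewrite !coef_poly !ltnS.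
have [kn|nk|->] := ltngtP k n; last 2 first.
- by rewrite !mulr0.
- by rewrite subrr mul0r mulr0.
rewrite -(subnSK kn) pochhammerS.
set m := (n - k.+1)%N; have -> : n%:R = k%:R + 1 + m%:R :> R by rewrite natr1 -natrD subnKC.
rewrite !factS !natrM exprS -[k.+1%:R]natr1 -[m.+1%:R]natr1 (_ : a + (k%:R + 1) + 1 = a + k%:R + 1 + 1); last by ring.
have := natr_fact_neq0 k; have := natr_fact_neq0 m.
move: (pochhammer _ m) ((-1) ^+ k) (k`!%:R) (m`!%:R) => P e fk fm fm0 fk0.
have k0 : k%:R + 1 != 0 :> R by rewrite natr1 pnatr_eq0.
have m0 : m%:R + 1 != 0 :> R by rewrite natr1 pnatr_eq0.
move: (k%:R) (m%:R) k0 m0 => k' m' k0 m0; field.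
by rewrite fm0 fk0 k0 m0.
Qed.

Lemma laguerre_ode n (a x : R) :
  x * (laguerre n a)^`(2).[x] + (a + 1 - x) * (laguerre n a)^`().[x]
  = - n%:R * (laguerre n a).[x].
Proof.
set p := laguerre n a.
suff : 'X * p^`(2) + ((a + 1)%:P - 'X) * p^`() = (- n%:R) *: p.
  by move/(congr1 (horner^~ x)); rewrite !hornerE.
apply/polyP => k; have H := laguerre_coef_rec n a k; rewrite -/p in H.
rewrite coefD mulrBl coefB coefCM coefZ !coefXM derivnS derivn1 !coef_deriv.
case: k H => [|k] H /=.
  by rewrite !mulr1n in H *; move: H; rewrite mul1r !add0r subr0 => ->; rewrite mulNr.
transitivity (k.+2%:R * (k.+1%:R + a + 1) * p`_k.+2 - k.+1%:R * p`_k.+1).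
  by ring.
by rewrite H; ring.
Qed.

Lemma jacobi_ode n (a b x : R) :
  (1 - x ^+ 2) * (jacobi n a b)^`(2).[x]
  + (b - a - (a + b + 2) * x) * (jacobi n a b)^`().[x] =
  - (n%:R * (n%:R + a + b + 1)) * (jacobi n a b).[x].
Proof.
set p := jacobi n a b.
pose co k : R := pochhammer (n%:R + a + b + 1) k * pochhammer (a + k%:R + 1) (n - k)
       / (k`! * (n - k)`!)%:R.
(* In the variable (x - 1) / 2 the equation is hypergeometric, so its coefficient recursion has only
   two terms. *)
pose q := \poly_(k < n.+1) co k; pose t : {poly R} := 2^-1 *: ('X - 1).
have pE : p = q \Po t.
  by rewrite /q poly_def raddf_sum /=; apply: eq_bigr => k _; rewrite comp_polyZ comp_Xn_poly.
have qrec k : k.+1%:R * (k%:R + a + 1) * q`_k.+1 = 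
    (n%:R - k%:R) * (n%:R + k%:R + a + b + 1) * q`_k.
  rewrite !coef_poly !ltnS /co.
  have [kn|nk|->] := ltngtP k n; last 2 first.
  - by rewrite !mulr0.
  - by rewrite subrr !mul0r mulr0.
  rewrite pochhammerSr -(subnSK kn) pochhammerS.
  set m := (n - k.+1)%N; have -> : n%:R = k%:R + 1 + m%:R :> R by rewrite natr1 -natrD subnKC.
  rewrite !factS !natrM -[k.+1%:R]natr1 -[m.+1%:R]natr1 (_ : a + (k%:R + 1) + 1 = a + k%:R + 1 + 1); last by ring.
  have := natr_fact_neq0 k; have := natr_fact_neq0 m.
  move: (pochhammer _ m) (pochhammer _ k) (k`!%:R) (m`!%:R) => P P' fk fm fm0 fk0.
  have k0 : k%:R + 1 != 0 :> R by rewrite natr1 pnatr_eq0.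
  have m0 : m%:R + 1 != 0 :> R by rewrite natr1 pnatr_eq0.
  move: (k%:R) (m%:R) k0 m0 => k' m' k0 m0; field.
  by rewrite fm0 fk0 k0 m0.
have qode : 'X * (1 + 'X) * q^`(2) + ((a + 1)%:P + (a + b + 2) *: 'X) * q^`() =
    (n%:R * (n%:R + a + b + 1)) *: q.
  apply/polyP => k; have H := qrec k.
  rewrite mulrDr mulr1 !mulrDl !coefD coefCM -scalerAl !coefZ -mulrA !coefXM derivnS derivn1 !coef_deriv.
  case: k H => [|k] H /=.
    by rewrite !mulr1n in H *; move: H; rewrite mul1r !add0r addr0 subr0 mulr0 addr0.
  case: k H => [|k] H /=.
    transitivity (2 * (1 + a + 1) * q`_2 + (a + b + 2) * q`_1); first by ring.
    by rewrite H; ring.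
  transitivity (k.+3%:R * (k.+2%:R + a + 1) * q`_k.+3 + (k.+1%:R + a + b + 2) * k.+2%:R * q`_k.+2).
    by ring.
  by rewrite H -[k.+2%:R]natr1; ring.
clear qrec; clearbody q.
have dt : t^`() = (2^-1)%:P.
  by rewrite /t derivZ derivB derivX derivC subr0 -mul_polyC mulr1.
have d1 : p^`().[x] = q^`().[t.[x]] / 2.
  by rewrite pE deriv_comp dt hornerM hornerC horner_comp.
have d2 : p^`(2).[x] = q^`(2).[t.[x]] / 4.
  rewrite derivnS derivn1 pE deriv_comp dt derivM derivC mulr0 addr0 deriv_comp dt.
  by rewrite !hornerM !hornerC horner_comp derivnS derivn1; field.
have d0 : p.[x] = q.[t.[x]] by rewrite pE horner_comp.
have : t.[x] = 2^-1 * (x - 1) by rewrite /t !hornerE.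
move: t.[x] d0 d1 d2 => T d0 d1 d2 TE.
have := congr1 (horner^~ T) qode; rewrite !hornerE /= -d0 => E.
have -> : - (n%:R * (n%:R + a + b + 1)) * p.[x] = - (n%:R * (n%:R + a + b + 1) * p.[x]) by ring.
by rewrite -E d1 d2 TE; field.
Qed.
End ClassicalEquations.

(** * Derivatives of a weight times a polynomial *)

Section QuasiPolynomials.
Variable R : realType.

(* [qiter s k q i] is the polynomial [q_i] of the formula
   [(d/dx)^i (w q) = w s^(-i) q_i], valid when [w' = k w / s]. *)
Fixpoint qiter (s : {poly R}) (k : R) (q : {poly R}) (i : nat) : {poly R} :=
  if i is i'.+1 then
    (k%:P - i'%:R *: s^`()) * qiter s k q i' + s * (qiter s k q i')^`()
  else q.

Definition qjet (w : R -> R) (s : {poly R}) (k : R) (q : {poly R}) (x : R) (i : nat) : R :=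
  w x * s.[x]^-1 ^+ i * (qiter s k q i).[x].

Lemma is_derive_invX (s : {poly R}) (x : R) i : s.[x] != 0 ->
  is_derive x 1 (fun y => s.[y]^-1 ^+ i) (- i%:R * s^`().[x] * s.[x]^-1 ^+ i.+1).
Proof.
move=> sx; elim: i => [|i IH].
  by rewrite mulr0n oppr0 !mul0r; exact: is_derive_const.
under eq_fun do rewrite exprS.
have h := is_derive_mul (is_deriveV sx (is_derive_poly s x)) IH.
apply: (is_derive_eq h).
rewrite /GRing.scale /= !exprS -natr1; field.
by rewrite sx.
Qed.

Lemma qjet_at (w : R -> R) (s : {poly R}) (k : R) (q : {poly R}) (x : R) :
  is_derive x 1 w (k * w x / s.[x]) -> s.[x] != 0 -> jet_at (qjet w s k q) x.
Proof.
move=> hw sx i; have h := is_derive_mul (is_derive_mul hw (is_derive_invX i sx))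
  (is_derive_poly (qiter s k q i) x).
apply: (is_derive_eq h).
rewrite /qjet [qiter _ _ _ i.+1]/= hornerD !hornerM hornerD hornerN hornerC hornerZ exprS; field.
by rewrite sx.
Qed.

End QuasiPolynomials.

(** * Jets and differential equations on the domain *)

Section Seeds.
Variable R : realType.
Variable c : params R.
Implicit Types (x : R) (u : R -> nat -> R).

Lemma near_domain x : domain c x -> \forall y \near x, domain c y.
Proof.
case: c => [g|g h] /= dx; first exact: lt_nbhsr.
case/andP: dx => x1 x2; near=> y; apply/andP; split; near: y.
  exact: lt_nbhsr.
exact: lt_nbhsl.
Unshelve. all: by end_near. Qed.

Lemma eq_is_derive_domain (f g : R -> R) x df : domain c x ->
  (forall y, domain c y -> f y = g y) -> is_derive x 1 f df -> is_derive x 1 g df.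
Proof.
move=> dx fg; apply: near_eq_is_derive; near=> y; apply: fg.
by near: y; exact: near_domain.
Unshelve. all: by end_near. Qed.

Lemma is_derive_domain_uniq (f g : R -> R) x df dg : domain c x ->
  (forall y, domain c y -> f y = g y) ->
  is_derive x 1 f df -> is_derive x 1 g dg -> df = dg.
Proof.
move=> dx fg hf hg; have h := eq_is_derive_domain dx fg hf.
by rewrite -(@derive_val _ _ _ _ _ _ _ hg) (@derive_val _ _ _ _ _ _ _ h).
Qed.

Definition jet_on u := forall x, domain c x -> jet_at u x.

(** Iterated derivatives see the seeds on a whole neighbourhood; as the domain is open, their junk
    values outside it do not matter. *)
Lemma derive1n_jet (f : R -> R) u : jet_on u ->
  (forall x, domain c x -> f x = u x 0%N) ->
  forall i x, domain c x -> derive1n i f x = u x i.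
Proof.
move=> ju fu; elim=> [|i IH] x dx; first exact: fu.
rewrite derive1nS derive1E.
have := eq_is_derive_domain dx (fun y dy => esym (IH y dy)) (ju x dx i).
by move=> h; rewrite (@derive_val _ _ _ _ _ _ _ h).
Qed.

Lemma wronskian_gwronsk (fs : seq (R -> R)) (us : seq (R -> nat -> R)) x :
  size fs = size us -> domain c x ->
  (forall j, (j < size us)%N -> jet_on (nth (fun _ _ => 0) us j)) ->
  (forall j, (j < size us)%N -> forall x, domain c x ->
     nth (fun=> 0) fs j x = nth (fun _ _ => 0) us j x 0%N) ->
  wronskian fs x = gwronsk 0 0 [seq u x | u <- us].
Proof.
move=> sfu dx ju fu; rewrite gwronskE size_map -sfu.
congr (\det _); apply/matrixP => i j; rewrite !mxE.
have jn : (j < size us)%N by rewrite -sfu.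
by rewrite (nth_map (fun _ _ => 0)) // (derive1n_jet (ju _ jn) (fu _ jn)).
Qed.

Definition ode_on (l : R) u := forall x, domain c x ->
  ode_jet (c2 c).[x] (c2 c)^`().[x] (c2 c)^`(2).[x] (c1 c).[x] (c1 c)^`().[x] l (u x).

(** Differentiating the relation of order i gives that of order i + 1: c2''' and c1'' vanish, and
    the coefficient of c2'' follows Pascal's rule. *)
Lemma ode_on_jet (l : R) u : jet_on u ->
  (forall x, domain c x -> (c2 c).[x] * u x 2 + (c1 c).[x] * u x 1%N = l * u x 0%N) ->
  ode_on l u.
Proof.
move=> ju H x dx i; elim: i x dx => [|i IH] x dx.
  by rewrite bin0n /= mulr0n !mul0r !add0r mul0r addr0; exact: H.
have D1 : forall p : {poly R}, is_derive x 1 (fun y => p.[y]) p^`().[x] by move=> p; exact: is_derive_poly.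
have hl := is_derive_mul (is_derive_const l x) (ju x dx i).
have hr := is_derive_add (is_derive_add (is_derive_mul (D1 (c2 c)) (ju x dx i.+2))
  (is_derive_mul (is_derive_add (is_derive_mul (is_derive_const i%:R x) (D1 (c2 c)^`()))
     (D1 (c1 c))) (ju x dx i.+1)))
  (is_derive_mul (is_derive_add (is_derive_mul (is_derive_const 'C(i, 2)%:R x) (D1 (c2 c)^`(2)))
     (is_derive_mul (is_derive_const i%:R x) (D1 (c1 c)^`()))) (ju x dx i)).
have E := is_derive_domain_uniq dx IH hr hl; rewrite -derivnS in E.
have c23 : (c2 c)^`(3) = 0.
  apply: derivn_poly0; case: (c) => [g|g h] /=; first by rewrite size_polyX.
  by rewrite (leq_trans (size_polyD _ _)) // geq_max size_poly1 size_polyN size_polyXn.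
have c12 : (c1 c)^`()^`() = 0.
  change ((c1 c)^`(2) = 0); apply: derivn_poly0.
  case: (c) => [g|g h] /=; rewrite (leq_trans (size_polyD _ _)) // geq_max size_polyN.
    by rewrite size_polyX andbT (leq_trans (size_polyC_leq1 _)).
  by rewrite (leq_trans (size_polyC_leq1 _)) // (leq_trans (size_scale_leq _ _)) // size_polyX.
rewrite c23 c12 horner0 in E.
rewrite binS bin1 natrD -[i.+1%:R]natr1.
transitivity (0 * u x i + l * u x i.+1); last by ring.
rewrite -E; ring.
Qed.
End Seeds.

(** * The seed functions *)

Section SeedJets.
Variable R : realType.
Variable c : params R.
Implicit Types (x : R) (v n : nat).

Definition wI x : R :=
  match c with
  | Laguerre _ => expR x
  | Jacobi _ h => powR ((1 + x) / 2) (2^-1 - h)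
  end.
Definition wII x : R :=
  match c with
  | Laguerre g => powR x (2^-1 - g)
  | Jacobi g _ => powR ((1 - x) / 2) (2^-1 - g)
  end.
(** The factor at which the weight is singular; the exponential has none, hence 1. *)
Definition sI : {poly R} :=
  match c with Laguerre _ => 1 | Jacobi _ _ => 1 + 'X end.
Definition sII : {poly R} :=
  match c with Laguerre _ => 'X | Jacobi _ _ => 1 - 'X end.
Definition kI : R :=
  match c with Laguerre _ => 1 | Jacobi _ h => 2^-1 - h end.
(** In the Jacobi case the sign is opposite to that of the exponent, because 1 - x has derivative
    -1. *)
Definition kII : R :=
  match c with Laguerre g => 2^-1 - g | Jacobi g _ => g - 2^-1 end.
Definition qI v : {poly R} :=
  match c with
  | Laguerre g => laguerre v (g - 2^-1) \Po - 'X
  | Jacobi g h => jacobi v (g - 2^-1) (2^-1 - h)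
  end.
Definition qII v : {poly R} :=
  match c with
  | Laguerre g => laguerre v (2^-1 - g)
  | Jacobi g h => jacobi v (2^-1 - g) (h - 2^-1)
  end.

Definition jetI v := qjet wI sI kI (qI v).
Definition jetII v := qjet wII sII kII (qII v).
Definition jetP n := qjet (fun=> 1) 1 0 (Defs.eigenpoly c n).

Lemma sI_neq0 x : domain c x -> sI.[x] != 0.
Proof.
rewrite /sI; case: c => [g _|g h /= /andP[x1 x2]]; first by rewrite hornerC oner_neq0.
by rewrite !hornerE lt0r_neq0 //; lra.
Qed.

Lemma sII_neq0 x : domain c x -> sII.[x] != 0.
Proof.
rewrite /sII; case: c => [g /= x0|g h /= /andP[x1 x2]]; first by rewrite hornerX lt0r_neq0.
by rewrite !hornerE lt0r_neq0 //; lra.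
Qed.

Lemma is_derive_powR_affine (a b r x : R) : 0 < a + b * x ->
  is_derive x 1 (fun y => powR (a + b * y) r) (r * b * powR (a + b * x) r / (a + b * x)).
Proof.
move=> ax.
have h1 : is_derive x 1 (fun y => a + b * y) b.
  have h := is_derive_add (is_derive_const a x)
    (is_derive_mul (is_derive_const b x) (is_derive_id x 1)).
  by apply: (is_derive_eq h); rewrite mul0r mulr1 !add0r.
have h2 := @is_derive1_powR R r _ ax.
have h := @is_derive1_comp R (fun y => powR y r) (fun y => a + b * y) x _ _ h2 h1.
apply: (is_derive_eq h).
rewrite powRB; last by rewrite lt0r_neq0 ?implybT.
by rewrite powRr1 ?ltW //; field; rewrite gt_eqF.
Qed.

Lemma is_derive_wI x : domain c x -> is_derive x 1 wI (kI * wI x / sI.[x]).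
Proof.
rewrite /wI /kI /sI; case: c => [g|g h] /= dx.
  by rewrite hornerC divr1 mul1r; exact: is_derive_expR.
have E y : (1 + y) / 2 = 2^-1 + 2^-1 * y :> R by field.
under eq_fun do rewrite E.
have x0 : 0 < 2^-1 + 2^-1 * x by lra.
have hh := is_derive_powR_affine (2^-1 - h) x0.
apply: (is_derive_eq hh); rewrite !hornerE -E.
field; rewrite lt0r_neq0 //; lra.
Qed.

Lemma is_derive_wII x : domain c x -> is_derive x 1 wII (kII * wII x / sII.[x]).
Proof.
rewrite /wII /kII /sII; case: c => [g|g h] /= dx.
  rewrite hornerX.
  have E y : y = 0 + 1 * y :> R by rewrite mul1r add0r.
  have x0 : 0 < 0 + 1 * x by rewrite -E.
  have hh := is_derive_powR_affine (2^-1 - g) x0.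
  rewrite -E mulr1 in hh.
  rewrite (_ : (fun y => _) = (fun y => powR (0 + 1 * y) (2^-1 - g))) //.
  by apply/funext => y; rewrite -E.
have E y : (1 - y) / 2 = 2^-1 + (- 2^-1) * y :> R by field.
under eq_fun do rewrite E.
have x0 : 0 < 2^-1 + (- 2^-1) * x by lra.
have hh := is_derive_powR_affine (2^-1 - g) x0.
apply: (is_derive_eq hh); rewrite !hornerE -E.
field; rewrite lt0r_neq0 //; lra.
Qed.

Lemma jetI_on v : jet_on c (jetI v).
Proof. by move=> x dx; exact: (@qjet_at R wI sI kI (qI v) x (is_derive_wI dx) (sI_neq0 dx)). Qed.

Lemma jetII_on v : jet_on c (jetII v).
Proof. by move=> x dx; exact: (@qjet_at R wII sII kII (qII v) x (is_derive_wII dx) (sII_neq0 dx)). Qed.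

Lemma jetP_on n : jet_on c (jetP n).
Proof.
move=> x dx; apply: (@qjet_at R (fun=> 1) 1 0 (Defs.eigenpoly c n) x).
  by rewrite !mul0r; exact: is_derive_const.
by rewrite hornerC oner_neq0.
Qed.

Lemma muIE v x : muI c v x = jetI v x 0%N.
Proof.
rewrite /jetI /qjet /= mulr1 /muI /wI /qI; case: c => [g|g h] //.
by rewrite horner_comp !hornerE.
Qed.

Lemma muIIE v x : muII c v x = jetII v x 0%N.
Proof. by rewrite /jetII /qjet /= mulr1 /muII /wII /qII; case: c. Qed.

Lemma eigenpolyE n x : (Defs.eigenpoly c n).[x] = jetP n x 0%N.
Proof. by rewrite /jetP /qjet expr0 mulr1 mul1r. Qed.

Lemma qjetE (w : R -> R) (s : {poly R}) (k : R) (q : {poly R}) x :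
  (qjet w s k q x 0%N = w x * q.[x]) *
  (qjet w s k q x 1%N = w x / s.[x] * (k * q.[x] + s.[x] * q^`().[x])) *
  (qjet w s k q x 2 = w x / s.[x] ^+ 2 * ((k - s^`().[x]) * (k * q.[x] + s.[x] * q^`().[x])
     + s.[x] * (k * q^`().[x] + s^`().[x] * q^`().[x] + s.[x] * q^`(2).[x]))).
Proof.
rewrite /qjet /= scale0r scale1r !subr0 expr0 mulr1 expr1 exprVn.
rewrite !derivD !derivM !derivC !mul0r !add0r !(hornerD, hornerM, hornerN, hornerC).
by split; [split|]; rewrite //; change (q^`(2)) with (q^`()^`()); ring.
Qed.

Lemma ode_jetI v : ode_on c (- energyI c v / 4) (jetI v).
Proof.
apply: ode_on_jet; first exact: jetI_on.
move=> x dx; rewrite /jetI !qjetE; move: dx.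
move: (wI x) => w; rewrite /sI /kI /qI /energyI; case: c => [g|g h] /= dx.
  have := laguerre_ode v (g - 2^-1) (- x).
  move: (laguerre _ _) => p; have x0 : x != 0 by rewrite lt0r_neq0.
  have d1 (q : {poly R}) : (q \Po - 'X)^`() = - (q^`() \Po - 'X).
    by rewrite deriv_comp derivN derivX mulrN mulr1.
  rewrite [p^`(2)]derivnS derivn1 !d1 derivN d1 opprK derivC.
  rewrite !(hornerN, hornerD, hornerX, hornerC, horner_comp).
  move: (p.[- x]) (p^`().[- x]) (p^`()^`().[- x]) => y0 y1 y2 E.
  have -> : y2 = ((g - 2^-1 + 1 - - x) * y1 + v%:R * y0) / x.
    apply: (mulfI x0); rewrite mulrCA divff // mulr1.
    by rewrite -[v%:R * y0]opprK -mulNr -E; ring.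
  by field.
have := jacobi_ode v (g - 2^-1) (2^-1 - h) x.
case/andP: dx => x1 x2.
have x10 : 1 + x != 0 by rewrite lt0r_neq0 //; lra.
have x20 : 1 - x != 0 by rewrite lt0r_neq0 //; lra.
have x3 : 1 - x ^+ 2 != 0.
  by rewrite (_ : 1 - x ^+ 2 = (1 + x) * (1 - x)) ?mulf_neq0 //; ring.
move: (jacobi _ _ _) => p; rewrite [p^`(2)]derivnS derivn1 derivD derivC derivX add0r.
rewrite !(hornerN, hornerD, hornerX, hornerC, hornerXn, hornerZ).
move: (p.[x]) (p^`().[x]) (p^`()^`().[x]) => y0 y1 y2 E.
set D := (2^-1 - h - _ - _) in E; set C := - (v%:R * _) in E.
have -> : y2 = (C * y0 - D * y1) / (1 - x ^+ 2) by rewrite -E; field.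
by rewrite /C /D; field; rewrite x3 x10.
Qed.

Lemma ode_jetII v : ode_on c (- energyII c v / 4) (jetII v).
Proof.
apply: ode_on_jet; first exact: jetII_on.
move=> x dx; rewrite /jetII !qjetE; move: dx.
move: (wII x) => w; rewrite /sII /kII /qII /energyII; case: c => [g|g h] /= dx.
  have := laguerre_ode v (2^-1 - g) x.
  move: (laguerre _ _) => p; have x0 : x != 0 by rewrite lt0r_neq0.
  rewrite [p^`(2)]derivnS derivn1 derivX.
  rewrite !(hornerN, hornerD, hornerX, hornerC).
  move: (p.[x]) (p^`().[x]) (p^`()^`().[x]) => y0 y1 y2 E.
  have -> : y2 = (- v%:R * y0 - (2^-1 - g + 1 - x) * y1) / x by rewrite -E; field.
  by field.
have := jacobi_ode v (2^-1 - g) (h - 2^-1) x.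
case/andP: dx => x1 x2.
have x10 : 1 + x != 0 by rewrite lt0r_neq0 //; lra.
have x20 : 1 - x != 0 by rewrite lt0r_neq0 //; lra.
have x3 : 1 - x ^+ 2 != 0.
  by rewrite (_ : 1 - x ^+ 2 = (1 + x) * (1 - x)) ?mulf_neq0 //; ring.
move: (jacobi _ _ _) => p; rewrite [p^`(2)]derivnS derivn1 derivB derivC derivX sub0r.
rewrite !(hornerN, hornerD, hornerX, hornerC, hornerXn, hornerZ).
move: (p.[x]) (p^`().[x]) (p^`()^`().[x]) => y0 y1 y2 E.
set D := (h - 2^-1 - _ - _) in E; set C := - (v%:R * _) in E.
have -> : y2 = (C * y0 - D * y1) / (1 - x ^+ 2) by rewrite -E; field.
by rewrite /C /D; field; rewrite x3 x20.
Qed.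

Lemma ode_jetP n : ode_on c (- energy c n / 4) (jetP n).
Proof.
apply: ode_on_jet; first exact: jetP_on.
move=> x _; rewrite /jetP !qjetE derivC !hornerC /energy.
case: c => [g|g h] /=.
  have := laguerre_ode n (g - 2^-1) x.
  move: (laguerre _ _) => p; rewrite [p^`(2)]derivnS derivn1.
  rewrite !(hornerN, hornerD, hornerX, hornerC).
  move: (p.[x]) (p^`().[x]) (p^`()^`().[x]) => y0 y1 y2 E.
  transitivity (x * y2 + (g - 2^-1 + 1 - x) * y1); first by field.
  by rewrite E; field.
have := jacobi_ode n (g - 2^-1) (h - 2^-1) x.
move: (jacobi _ _ _) => p; rewrite [p^`(2)]derivnS derivn1.
rewrite !(hornerN, hornerD, hornerX, hornerC, hornerXn, hornerZ).
move: (p.[x]) (p^`().[x]) (p^`()^`().[x]) => y0 y1 y2 E.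
transitivity ((1 - x ^+ 2) * y2 + (h - 2^-1 - (g - 2^-1) - (g - 2^-1 + (h - 2^-1) + 2) * x) * y1).
  by field.
by rewrite E; field.
Qed.
End SeedJets.

(** * Moving columns *)

Section MovingColumns.
Variable R : comNzRingType.
Implicit Types (S T U : seq (nat -> R)) (u v : nat -> R).

Definition coldet S : R := natdet (size S) (fun i j => nth (fun=> 0) S j i).

Lemma coldet_swap S u v T :
  coldet (S ++ u :: v :: T) = - coldet (S ++ v :: u :: T).
Proof.
rewrite /coldet.
have -> : size (S ++ v :: u :: T) = size (S ++ u :: v :: T) by rewrite !size_cat.
rewrite -(@natdet_swap_cols _ _ _ (size S) (size S).+1); rewrite ?size_cat /=; try by lia.
apply: eq_natdet => i j _ _; rewrite !nth_cat.
have [->|jS] := eqVneq j (size S).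
  by rewrite ltnn ltnNge leqnSn /= subnn subSnn.
have [->|jS'] := eqVneq j (size S).+1.
  by rewrite ltnn ltnNge leqnSn /= subnn subSnn.
case: ltnP => // Sj; have -> : (j - size S = (j - size S - 2).+2)%N by lia.
by [].
Qed.

Lemma coldet_move S u T U :
  coldet (S ++ u :: T ++ U) = (-1) ^+ size T * coldet (S ++ T ++ u :: U).
Proof.
elim: T S => [|v T IH] S /=; first by rewrite mul1r.
by rewrite coldet_swap -cat_rcons IH cat_rcons exprS !mulN1r mulNr.
Qed.

Lemma coldet_rot S T U : 
  coldet (S ++ T ++ U) = (-1) ^+ (size S * size T) * coldet (T ++ S ++ U).
Proof.
elim: S U => [|u S IH] U /=; first by rewrite mul1r.
have := coldet_move [::] u (S ++ T) U; rewrite /= -!catA => ->.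
rewrite IH /= (coldet_move T u S U) size_cat !mulrA -!exprD mulSn.
by rewrite -signr_odd -[in RHS]signr_odd !oddD; congr (_ * _); do 3!case: (odd _).
Qed.
End MovingColumns.

(** * Polynomiality *)

Section DistinctSums.

Lemma sumn_sorted_ge (t : seq nat) k : sorted ltn t -> all (leq k) t ->
  (\sum_(i < size t) (k + i) <= sumn t)%N.
Proof.
elim: t k => [|x t IH] k /=; first by rewrite big_ord0.
rewrite path_sortedE; last exact: ltn_trans.
move=> /andP[xt st] /andP[kx kt]; rewrite big_ord_recl addn0 leq_add //.
apply: leq_trans (IH k.+1 st _); last first.
  by apply: sub_all xt => y xy; exact: leq_ltn_trans xy.
by apply: leq_sum => i _; rewrite /= /bump; lia.
Qed.

Lemma sum_injective_ge p (f : 'I_p -> nat) : injective f ->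
  ('C(p, 2) <= \sum_(j < p) f j)%N.
Proof.
move=> fi; pose t := sort leq [seq f j | j <- enum 'I_p].
have st : size t = p by rewrite size_sort size_map size_enum_ord.
have -> : (\sum_(j < p) f j = sumn t)%N.
  rewrite sumnE (perm_big [seq f j | j <- enum 'I_p]) /=; last by rewrite perm_sort.
  by rewrite big_map big_enum.
have : sorted ltn t.
  rewrite ltn_sorted_uniq_leq sort_uniq map_inj_uniq // enum_uniq /=.
  exact: (sort_sorted leq_total).
move/(@sumn_sorted_ge t 0); rewrite st -bin2_sum big_mkord; apply.
by apply/allP.
Qed.

End DistinctSums.

(** * Combining polynomials to vanish to prescribed orders *)

Section Divisibility.
Variable F : fieldType.
Implicit Types (s q : {poly F}).

(** From the decomposition P C = L U, with V = L^-1 P. *)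
Lemma triangularize p (C : 'M[F]_p) : exists2 V : 'M[F]_p, \det V != 0 &
  forall i j : 'I_p, (j < i)%N -> (V *m C) i j = 0.
Proof.
case: p C => [|p] C; first by exists 1%:M; [rewrite det1 oner_neq0 | case].
have E := cormen_lup_correct C; have dL := cormen_lup_detL C.
have hU := cormen_lup_upper C; have hP := cormen_lup_perm C.
move: (cormen_lup C) E dL hU hP => [[P L] U] /= E dL hU hP.
have Lu : L \in unitmx by rewrite unitmxE dL unitr1.
exists (invmx L *m P).
  have /existsP[sg /eqP ->] := hP.
  rewrite det_mulmx det_inv dL invr1 mul1r det_perm.
  by rewrite signr_eq0.
move=> i j ji; rewrite -mulmxA.
by have -> : P *m C = L *m U by []; rewrite mulKmx // hU.
Qed.

Definition affine_factor s := (s == 1) || (size s == 2).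

(** [C] holds the first p Taylor coefficients of the [q l] at the root [z] of [s]. Once it is
    triangular, the k-th combination has no coefficient below order k. *)
Lemma combine_divisible s p (q : nat -> {poly F}) : affine_factor s ->
  exists2 V : 'M[F]_p, \det V != 0 &
    forall k : 'I_p, s ^+ k %| \sum_(l < p) V k l *: q l.
Proof.
case/orP => [/eqP ->|s2].
  by exists 1%:M => [|k]; [rewrite det1 oner_neq0 | rewrite expr1n dvd1p].
have s1 : s`_1 != 0 by have := lead_coef_eq0 s; rewrite lead_coefE (eqP s2) -size_poly_eq0 (eqP s2) => ->.
pose z := - s`_0 / s`_1.
have sE : s = s`_1 *: ('X - z%:P).
  apply/polyP => i; rewrite coefZ coefB coefX coefC; case: i => [|[|i]] /=.
  - by rewrite /z sub0r mulNr opprK mulrCA divff ?mulr1.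
  - by rewrite subr0 mulr1.
  - by rewrite subr0 mulr0 nth_default // (eqP s2).
pose C : 'M[F]_p := \matrix_(l, m) (q l \Po ('X + z%:P))`_m.
have [V dV hV] := triangularize C; exists V => // k.
have -> : s ^+ k = s`_1 ^+ k *: ('X - z%:P) ^+ k by rewrite {1}sE exprZn.
rewrite dvdpZl ?expf_neq0 //.
pose Q := (\sum_(l < p) V k l *: q l) \Po ('X + z%:P).
have tQ : take_poly k Q = 0.
  apply/polyP => m; rewrite coef_take_poly coef0; case: ifP => // mk.
  have mp : (m < p)%N by apply: ltn_trans mk (ltn_ord k).
  transitivity ((V *m C) k (Ordinal mp)); last exact: hV.
  rewrite mxE /Q [_ \Po _]raddf_sum /= coef_sum; apply: eq_bigr => l _.
  by rewrite /= comp_polyZ coefZ mxE.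
rewrite -(comp_polyXaddC_K (\sum_(l < p) _) z) -/Q -(poly_take_drop k Q) tQ add0r.
by rewrite comp_polyM comp_Xn_poly dvdp_mull.
Qed.

End Divisibility.

Section ColumnClass.
Variable R : realType.
Implicit Types (s q : {poly R}).

Lemma qiter_lincomb s k (I : Type) (r : seq I) (a : I -> R) (q : I -> {poly R}) i :
  qiter s k (\sum_(l <- r) a l *: q l) i = \sum_(l <- r) a l *: qiter s k (q l) i.
Proof.
elim: i => //= i ->; rewrite raddf_sum /= !mulr_sumr -big_split; apply: eq_bigr => l _.
by rewrite derivZ scalerDr !scalerAr.
Qed.

Lemma dvdp_qiter s k q m i : s ^+ m %| q -> s ^+ m %| qiter s k q i.
Proof.
move=> h; elim: i => //= i /dvdpP[u ->]; apply: dvdp_add.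
  by rewrite !dvdp_mull.
rewrite derivM mulrDr; apply: dvdp_add; first by rewrite !dvdp_mull.
case: m {h} => [|m]; first by rewrite dvd1p.
rewrite deriv_exp /= (_ : s * _ = (u * s^`() *+ m.+1) * s ^+ m.+1) ?dvdp_mull //.
by rewrite exprS; ring.
Qed.

(* After constant-coefficient column operations the [j]-th base polynomial is divisible
   by [s ^ j]; each term of the Leibniz expansion is then divisible by [s] to the power
   [\sum_j j] plus a sum of [p] distinct naturals. *)
Lemma dvdp_natdet s k p m (q : nat -> {poly R}) (A : nat -> nat -> {poly R}) :
  affine_factor s ->
  (forall i j, (i < p + m)%N -> (j < p)%N ->
    A i j = s ^+ (p + m - i.+1) * qiter s k (q j) i) ->
  s ^+ (p * p.-1) %| natdet (p + m) A.
Proof.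
move=> sa HA; have [V dV hV] := combine_divisible p q sa.
(* [G] combines the first p columns only; its determinant is a nonzero constant, so divisibility is
   unaffected. *)
pose G : 'M[{poly R}]_(p + m) := block_mx (map_mx polyC V^T) 0 0 1%:M.
have dG : \det G = (\det V)%:P.
  by rewrite det_ublock det1 mulr1 det_map_mx det_tr.
pose B := natmx (p + m) A *m G.
suff : s ^+ (p * p.-1) %| \det B.
  by rewrite /B det_mulmx dG mulrC mul_polyC dvdpZr.
pose e (i j : 'I_(p + m)) := if (j < p)%N then (p + m - i.+1 + j)%N else 0%N.
have eB i j : s ^+ e i j %| B i j.
  rewrite /e; case: ltnP => jp; last by rewrite dvd1p.
  have -> : j = lshift m (Ordinal jp) by apply: val_inj.
  set J := Ordinal jp; rewrite mxE big_split_ord /= [X in _ + X]big1 ?addr0; last first.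
    by move=> l _; rewrite block_mxEdl [X in _ * X]mxE mulr0.
  have -> : \sum_(l < p) natmx (p + m) A i (lshift m l) * G (lshift m l) (lshift m J) =
      s ^+ (p + m - i.+1) * qiter s k (\sum_(l < p) V J l *: q l) i.
    rewrite qiter_lincomb mulr_sumr; apply: eq_bigr => l _.
    by rewrite block_mxEul !mxE HA //= mulrC mul_polyC scalerAr.
  rewrite exprD; apply: dvdp_mul => //; apply: dvdp_qiter; exact: (hV J).
rewrite /determinant; elim/big_ind: _ => [|u v|sg _]; [exact: dvdp0|exact: dvdp_add|].
rewrite dvdp_mull //.
apply: (@dvdp_trans _ (\prod_i s ^+ e i (sg i))); last first.
  elim/big_ind2: _ => [|u u' v v'|i _]; [exact: dvd1p|exact: dvdp_mul|exact: eB].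
rewrite -expr_sum; apply: dvdp_exp2l.
rewrite (reindex_inj (@perm_inj _ sg^-1)) /=.
under eq_bigr do rewrite permKV.
rewrite big_split_ord /= [X in (_ + X)%N]big1 ?addn0; last first.
  by move=> j _; rewrite /e ltnNge leq_addr.
have -> : (\sum_(j < p) e (sg^-1%g (lshift m j)) (lshift m j) =
   \sum_(j < p) (p + m - (sg^-1%g (lshift m j)).+1) + \sum_(j < p) j)%N.
  by rewrite -big_split; apply: eq_bigr => j _; rewrite /e /= ltn_ord.
have -> : (p * p.-1 = 'C(p, 2) + 'C(p, 2))%N.
  by rewrite addnn bin2 -[LHS]odd_double_half oddM; case: p {V dV hV G dG B eB e sg q A HA} => //= p; rewrite andNb.
apply: leq_add; last by rewrite -bin2_sum big_mkord.
apply: sum_injective_ge => i j /= E.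
have := ltn_ord (sg^-1%g (lshift m i)); have := ltn_ord (sg^-1%g (lshift m j)) => hi hj.
by apply/(@lshift_inj p m)/(@perm_inj _ sg^-1)/val_inj => /=; move: E hi hj; lia.
Qed.

End ColumnClass.

(** * Clearing denominators in Wronskians of seeds *)

Section Polynomiality.
Variable R : realType.
Implicit Types (x : R) (A : index_pair).

Record qpoly := QPoly {
  qweight : R -> R; qden : {poly R}; qexp : R; qpol : {poly R} }.

Definition jet (d : qpoly) := qjet (qweight d) (qden d) (qexp d) (qpol d).

(** The i-th derivative has denominator s^i; all rows are brought to s^(r-1), which can then be
    taken out of the column. *)
Definition cleared_col r (d : qpoly) (i : nat) : {poly R} :=
  qden d ^+ (r - i.+1) * qiter (qden d) (qexp d) (qpol d) i.

Lemma natdet_scale (T : comNzRingType) n (a : nat -> T) (B : nat -> nat -> T) :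
  natdet n (fun i j => a j * B i j) = (\prod_(j < n) a j) * natdet n B.
Proof.
rewrite /natdet /determinant mulr_sumr; apply: eq_bigr => s _.
under eq_bigr do rewrite mxE.
rewrite big_split /= mulrCA; congr (_ * (_ * _)).
  by rewrite [RHS](reindex_inj (@perm_inj _ s)).
by apply: eq_bigr => i _; rewrite mxE.
Qed.

Lemma horner_natdet n (B : nat -> nat -> {poly R}) x :
  (natdet n B).[x] = natdet n (fun i j => (B i j).[x]).
Proof.
rewrite /natdet -horner_evalE -det_map_mx; congr (\det _).
by apply/matrixP => i j; rewrite !mxE.
Qed.

Lemma gwronsk_cleared (ds : seq qpoly) x : all (fun d => (qden d).[x] != 0) ds ->
  gwronsk 0 0 [seq jet d x | d <- ds] =
  (\prod_(d <- ds) (qweight d x * (qden d).[x]^-1 ^+ (size ds).-1)) *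
  (coldet [seq cleared_col (size ds) d | d <- ds]).[x].
Proof.
move=> sx; rewrite gwronskE /coldet !size_map horner_natdet.
case: ds sx => [|d0 ds0] sx; first by rewrite !natdet0 big_nil mulr1.
set ds := d0 :: ds0 in sx *.
pose a j := let d := nth d0 ds j in qweight d x * (qden d).[x]^-1 ^+ (size ds).-1.
rewrite (big_nth d0) big_mkord -/(\prod_(j < size ds) a j) -natdet_scale; apply: eq_natdet => i j hi hj.
rewrite !(nth_map d0) // /jet /qjet /cleared_col hornerM horner_exp.
have := all_nthP d0 sx j hj; set d := nth d0 ds j => dx.
rewrite -!mulrA; congr (_ * _); rewrite mulrA; congr (_ * _).
have -> : (size ds).-1 = (i + (size ds - i.+1))%N by lia.
by rewrite exprD -mulrA -exprMn mulVf // expr1n mulr1.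
Qed.

Variable c : params R.

Definition specI v := QPoly (wI c) (sI c) (kI c) (qI c v).
Definition specII v := QPoly (wII c) (sII c) (kII c) (qII c v).
Definition specP n := QPoly (fun=> 1) 1 0 (Defs.eigenpoly c n).

Lemma coprime_sI_sII : coprimep (sI c) (sII c).
Proof.
rewrite /sI /sII; case: c => [g|g h]; first by rewrite coprime1p.
apply/Bezout_coprimepP; exists ((2^-1)%:P, (2^-1)%:P) => /=.
rewrite -mulrDr (_ : 1 + 'X + (1 - 'X) = 2%:P); last by rewrite polyCMn; ring.
by rewrite -polyCM mulVf ?pnatr_eq0 // eqpxx.
Qed.

Lemma affine_sI : affine_factor (sI c).
Proof.
rewrite /affine_factor /sI; case: c => [g|g h]; rewrite ?eqxx //.
by rewrite addrC size_XaddC orbT.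
Qed.

Lemma affine_sII : affine_factor (sII c).
Proof.
rewrite /affine_factor /sII; case: c => [g|g h]; first by rewrite size_polyX orbT.
by rewrite -opprB size_polyN size_XsubC orbT.
Qed.

(** Each type is treated as the leading block of columns, type II after a rotation that changes at
    most the sign; the two powers combine by coprimality. *)
Lemma dvdp_cleared A (E : seq qpoly) 
    (p := size (typeI A)) (q := size (typeII A)) 
    (ds := map specI (typeI A) ++ map specII (typeII A) ++ E) :
  sI c ^+ (p * p.-1) * sII c ^+ (q * q.-1) %|
    coldet [seq cleared_col (size ds) d | d <- ds].
Proof.
have sz : size ds = (p + (q + size E))%N by rewrite !size_cat !size_map.
rewrite Gauss_dvdp ?coprimep_expl ?coprimep_expr ?coprime_sI_sII //.
apply/andP; split.
  rewrite /coldet size_map sz; apply: (@dvdp_natdet _ (sI c) (kI c) _ _ (fun j => qI c (nth 0%N (typeI A) j))).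
    exact: affine_sI.
  move=> i j hi jp; rewrite (nth_map (specI 0)) ?sz; last by lia.
  by rewrite /ds nth_cat size_map jp (nth_map 0%N).
rewrite !map_cat coldet_rot -signr_odd.
rewrite (_ : (-1) ^+ odd _ = ((-1) ^+ odd (size (typeI A) * size (typeII A)))%:P); last first.
  by rewrite !size_map; case: (odd _); rewrite ?expr1 ?expr0 ?polyCN.
rewrite mul_polyC dvdpZr ?signr_eq0 //.
rewrite /coldet !size_cat !size_map -/p -/q (_ : p + (q + size E) = q + (p + size E))%N; last by lia.
apply: (@dvdp_natdet _ (sII c) (kII c) _ _ (fun j => qII c (nth 0%N (typeII A) j))).
  exact: affine_sII.
by move=> i j hi jp; rewrite nth_cat !size_map jp (nth_map (specII 0)) ?size_map // (nth_map 0%N).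
Qed.

Lemma powR_expM (a r : R) n m : 0 < a ->
  powR a r ^+ n * powR a ((m%:R - r) * n%:R) = a ^+ (m * n).
Proof.
move=> a0; rewrite -powR_mulrn ?powR_ge0 // -powRrM -powRD; last first.
  by rewrite lt0r_neq0 ?implybT.
by rewrite -mulrDl addrC subrK -natrM powR_mulrn // ltW.
Qed.

(** The powers of 2 left over because the Jacobi prefactor is written in (1 + x) / 2 and (1 - x) /
    2, the denominators in 1 + x and 1 - x. *)
Definition prefactor_const A (e : nat) : R :=
  match c with
  | Laguerre _ => 1
  | Jacobi _ _ => 2^-1 ^+ (size (typeI A) * (size (typeII A) + e)
                           + size (typeII A) * (size (typeI A) + e))
  end.

(** The non-integer exponents of the weights cancel against those of the prefactor. Here e = 0 is
    the case of Xi and e = 1 that of P. *)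
Lemma wronskian_prefactor A (e : nat) x (p := size (typeI A)) (q := size (typeII A)) :
  domain c x ->
  wI c x ^+ p * wII c x ^+ q * prefactor c A (e%:R - 2^-1) x =
  prefactor_const A e * ((sI c).[x] ^+ (p * (q + e)) * (sII c).[x] ^+ (q * (p + e))).
Proof.
rewrite /wI /wII /prefactor /sI /sII /prefactor_const -/p -/q; case: c => [g|g h] /= dx.
  rewrite mul1r hornerC hornerX expr1n mul1r [(q * _)%N]mulnC -(powR_expM (2^-1 - g) _ _ dx).
  rewrite natrD (_ : p%:R + g + (e%:R - 2^-1) = p%:R + e%:R - (2^-1 - g)); last by ring.
  by rewrite -expRM_natl expRN; field; rewrite expR_eq0.
case/andP: dx => x1 x2.
have x10 : 0 < (1 + x) / 2 by lra.
have x20 : 0 < (1 - x) / 2 by lra.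
rewrite !(hornerD, hornerN, hornerC, hornerX) exprD.
transitivity (((1 + x) / 2) ^+ ((q + e) * p) * ((1 - x) / 2) ^+ ((p + e) * q)); last first.
  by rewrite !exprMn [(p * _)%N]mulnC [(q * _)%N]mulnC; ring.
rewrite -(powR_expM (2^-1 - g) _ _ x20) -(powR_expM (2^-1 - h) _ _ x10) !natrD.
rewrite (_ : p%:R + g + (e%:R - 2^-1) = p%:R + e%:R - (2^-1 - g)); last by ring.
rewrite (_ : q%:R + h + (e%:R - 2^-1) = q%:R + e%:R - (2^-1 - h)); last by ring.
by ring.
Qed.

(** The powers balance: clearing type I costs sI^(p N) with N = (p - 1) + (q + e), where e is the
    size of [E]; the prefactor returns sI^(p (q + e)), and the missing sI^(p (p - 1)) is the power
    known to divide the determinant. Type II is symmetric. *)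
Lemma wronskian_polynomial A (E : seq qpoly) 
    (ds := map specI (typeI A) ++ map specII (typeII A) ++ E) :
  (forall d x, List.In d E -> qden d = 1 /\ qweight d x = 1) ->
  exists X : {poly R}, forall x, domain c x ->
  X.[x] = gwronsk 0 0 [seq jet d x | d <- ds] * prefactor c A ((size E)%:R - 2^-1) x.
Proof.
move=> HE; have /dvdpP[Q QE] := dvdp_cleared A E; rewrite -/ds in QE.
exists (prefactor_const A (size E) *: Q) => x dx.
have s1 := sI_neq0 dx; have s2 := sII_neq0 dx.
have allE : all (fun d => (qden d).[x] != 0) E /\
   \prod_(d <- E) (qweight d x * (qden d).[x]^-1 ^+ (size ds).-1) = 1.
  move: (size ds) => N; elim: E HE {ds QE} => [|d E IH] HE; first by rewrite big_nil.
  have [|h1 h2] := IH; first by move=> d' y h; apply: HE; right.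
  rewrite big_cons h2 /= h1; have [-> ->] := HE d x (or_introl erefl).
  by rewrite hornerC oner_neq0 invr1 expr1n !mulr1.
rewrite gwronsk_cleared -/ds; last first.
  by rewrite /ds !all_cat !all_map /= allE.1 andbT; apply/andP; split; apply/allP.
rewrite QE {1}/ds !big_cat !big_map /= allE.2 mulr1.
rewrite !big_const_seq !count_predT !iter_mulr_1 !hornerM !horner_exp hornerZ.
set p := size (typeI A); set q := size (typeII A); set N := (size ds).-1.
(* For p = 0 the truncated [p.-1] can break the formula for [N], but then every power of [sI]
   involved is 1. *)
have E1 : N = (p.-1 + (q + size E))%N \/ p = 0%N.
  by rewrite /N !size_cat !size_map -/p -/q; have [->|p0] := posnP p; [right|left; lia].
have E2 : N = (q.-1 + (p + size E))%N \/ q = 0%N.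
  by rewrite /N !size_cat !size_map -/p -/q; have [->|q0] := posnP q; [right|left; lia].
have F1 : (sI c).[x]^-1 ^+ N ^+ p * ((sI c).[x] ^+ (p * p.-1) * (sI c).[x] ^+ (p * (q + size E))) = 1.
  case: E1 => [->|->]; last by rewrite !mul0n !expr0 !mulr1.
  by rewrite -exprM -exprD -mulnDr [(p * _)%N]mulnC -exprMn mulVf // expr1n.
have F2 : (sII c).[x]^-1 ^+ N ^+ q * ((sII c).[x] ^+ (q * q.-1) * (sII c).[x] ^+ (q * (p + size E))) = 1.
  case: E2 => [->|->]; last by rewrite !mul0n !expr0 !mulr1.
  by rewrite -exprM -exprD -mulnDr [(q * _)%N]mulnC -exprMn mulVf // expr1n.
have := wronskian_prefactor A (size E) dx; rewrite -/p -/q => W.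
rewrite !exprMn.
transitivity (((wI c x ^+ p * wII c x ^+ q * prefactor c A ((size E)%:R - 2^-1) x)) * Q.[x] *
  ((sI c).[x]^-1 ^+ N ^+ p * (sI c).[x] ^+ (p * p.-1)) *
  ((sII c).[x]^-1 ^+ N ^+ q * (sII c).[x] ^+ (q * q.-1))); last by ring.
rewrite W.
transitivity (prefactor_const A (size E) * Q.[x] *
 ((sI c).[x]^-1 ^+ N ^+ p * ((sI c).[x] ^+ (p * p.-1) * (sI c).[x] ^+ (p * (q + size E)))) *
 ((sII c).[x]^-1 ^+ N ^+ q * ((sII c).[x] ^+ (q * q.-1) * (sII c).[x] ^+ (q * (p + size E)))));
  last by ring.
by rewrite F1 F2 !mulr1.
Qed.
End Polynomiality.

(** * Gauge factors *)

Section Gauge.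
Variable R : realType.
Variable c : params R.
Implicit Types (x p q s : R).

(** The logarithmic derivative of [prefactor], with real p and q so that p + 1 and q + 1 can be
    substituted. *)
Definition pref_log p q s x : R :=
  match c with
  | Laguerre g => (p + g + s) * q / x - p
  | Jacobi g h => - ((p + g + s) * q) / (1 - x) + (q + h + s) * p / (1 + x)
  end.

Definition pref_log' p q s x : R :=
  match c with
  | Laguerre g => - ((p + g + s) * q) / x ^+ 2
  | Jacobi g h =>
      - ((p + g + s) * q) / (1 - x) ^+ 2 - (q + h + s) * p / (1 + x) ^+ 2
  end.

Lemma is_derive_prefactor A s x : domain c x ->
  is_derive x 1 (prefactor c A s) (prefactor c A s x *
    pref_log (size (typeI A))%:R (size (typeII A))%:R s x).
Proof.
rewrite /prefactor /pref_log; move: ((size (typeI A))%:R) ((size (typeII A))%:R) => p q; case: c => [g|g h] /= dx.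
  have x0 : x != 0 by rewrite lt0r_neq0.
  have E y : y = 0 + 1 * y :> R by rewrite mul1r add0r.
  have dx' : 0 < 0 + 1 * x by rewrite -E.
  have h1 := is_derive_powR_affine ((p + g + s) * q) dx'.
  rewrite -E mulr1 in h1.
  have h2 : is_derive x 1 (fun y => expR (- (p * y))) (expR (- (p * x)) * - p).
    have h3 : is_derive x 1 (fun y => - (p * y)) (- p).
      have h4 := is_derive_mul (is_derive_const (- p) x) (is_derive_id x 1).
      rewrite mul0r add0r mulr1 in h4.
      by under eq_fun do rewrite -mulNr.
    exact: (@is_derive1_comp R expR (fun y => - (p * y)) x _ _ (is_derive_expR _) h3).
  rewrite (_ : (fun y => _) = (fun y => powR (0 + 1 * y) ((p + g + s) * q) * expR (- (p * y)))); last first.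
    by apply/funext => y; rewrite -E.
  apply: (is_derive_eq (is_derive_mul h1 h2)); rewrite -E; field.
  exact: x0.
case/andP: dx => x1 x2.
have E1 y : (1 + y) / 2 = 2^-1 + 2^-1 * y :> R by field.
have E2 y : (1 - y) / 2 = 2^-1 + (- 2^-1) * y :> R by field.
have x10 : 0 < 2^-1 + 2^-1 * x by lra.
have x20 : 0 < 2^-1 + (- 2^-1) * x by lra.
have h1 := is_derive_powR_affine ((p + g + s) * q) x20.
have h2 := is_derive_powR_affine ((q + h + s) * p) x10.
under eq_fun do rewrite E2 E1.
apply: (is_derive_eq (is_derive_mul h1 h2)); rewrite -E1 -E2; field.
by rewrite !lt0r_neq0 //; lra.
Qed.

Lemma is_derive_pref_log p q s x : domain c x ->
  is_derive x 1 (pref_log p q s) (pref_log' p q s x).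
Proof.
have inv (P : {poly R}) : P.[x] != 0 ->
    is_derive x 1 (fun y => P.[y]^-1) (- P^`().[x] / P.[x] ^+ 2).
  move=> h; apply: (is_derive_eq (is_deriveV h (is_derive_poly P x))).
  by rewrite /GRing.scale /=; field.
rewrite /pref_log /pref_log'; case: c => [g|g h] /= dx.
  have x0 : 'X.[x] != 0 by rewrite hornerX lt0r_neq0.
  have h1 := is_derive_add (is_derive_mul (is_derive_const ((p + g + s) * q) x) (inv _ x0))
    (is_derive_const (- p) x).
  rewrite derivX hornerC hornerX in h1.
  under eq_fun do rewrite -[X in _ / X]hornerX.
  by apply: (is_derive_eq h1); ring.
case/andP: dx => x1 x2.
have y1 : (1 - 'X).[x] != 0 by rewrite !hornerE lt0r_neq0 //; lra.
have y2 : (1 + 'X).[x] != 0 by rewrite !hornerE lt0r_neq0 //; lra.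
have h1 := is_derive_add
  (is_derive_mul (is_derive_const (- ((p + g + s) * q)) x) (inv _ y1))
  (is_derive_mul (is_derive_const ((q + h + s) * p) x) (inv _ y2)).
rewrite (_ : (fun y => _) = (fun y => - ((p + g + s) * q) * (1 - 'X).[y]^-1 +
   (q + h + s) * p * (1 + 'X).[y]^-1)); last first.
  by apply/funext => y; rewrite !hornerE.
apply: (is_derive_eq h1); rewrite derivB derivD derivX derivC !(hornerD, hornerN, hornerC, hornerX); ring.
Qed.

Lemma horner_gauge (X : {poly R}) (W W1 W2 pi l l' : R -> R) x :
  (forall y, domain c y -> X.[y] = W y * pi y) ->
  (forall y, domain c y -> is_derive y 1 W (W1 y)) ->
  (forall y, domain c y -> is_derive y 1 W1 (W2 y)) ->
  (forall y, domain c y -> is_derive y 1 pi (pi y * l y)) ->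
  (forall y, domain c y -> is_derive y 1 l (l' y)) ->
  domain c x ->
  [/\ X.[x] = W x * pi x, X^`().[x] = (W1 x + W x * l x) * pi x &
      X^`(2).[x] = (W2 x + 2 * W1 x * l x + W x * (l' x + l x ^+ 2)) * pi x].
Proof.
move=> XE dW dW1 dpi dl dx.
have X1 y : domain c y -> X^`().[y] = (W1 y + W y * l y) * pi y.
  move=> dy; have h := is_derive_mul (dW y dy) (dpi y dy).
  rewrite (is_derive_domain_uniq dy XE (is_derive_poly X y) h); ring.
split; [exact: XE | exact: X1 |].
have h := is_derive_mul (is_derive_add (dW1 x dx) (is_derive_mul (dW x dx) (dl x dx))) (dpi x dx).
rewrite (is_derive_domain_uniq dx X1 (is_derive_poly X^`() x) h); ring.
Qed.

Lemma poly_eq_domain (X Y : {poly R}) :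
  (forall x, domain c x -> X.[x] = Y.[x]) -> X = Y.
Proof.
(* The points 1 / (i + 2) lie in (0, 1), which both domains contain. *)
move=> XY; apply/eqP; rewrite -subr_eq0; apply/eqP/(@roots_geq_poly_eq0 _ _
  [seq i.+2%:R^-1 | i <- iota 0 (size (X - Y))]); last by rewrite size_map size_iota.
  apply/allP => _ /mapP[i _ ->]; rewrite /root hornerD hornerN XY ?subrr //.
  have i0 : 0 < i.+2%:R^-1 :> R by rewrite invr_gt0.
  have i1 : i.+2%:R^-1 < 1 :> R by rewrite invf_lt1 ?ltr1n.
  by case: c => [g|g h] //=; rewrite i1 (lt_trans _ i0) // ltrN10.
rewrite map_inj_uniq ?iota_uniq // => i j /invr_inj /eqP.
by rewrite eqr_nat => /eqP[].
Qed.

Lemma bilinear_over_field (K : fieldType) (u u1 u2 f f1 f2 a b b' e : K) : u != 0 ->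
  u * (-4 * (a * f2 + (b - 2 * a * (u1 / u)) * f1 + (a * (u2 / u) - b' * (u1 / u)) * f)
    - e * f) =
  -4 * (a * (u * f2 - 2 * (u1 * f1) + u2 * f) + b * (u * f1) - b' * (u1 * f))
    - e * (u * f).
Proof. by move=> u0; field. Qed.

(** For nonzero [xi] this clears denominators; for [xi = 0] the quotients are junk, but the factor
    [toF xi] and the bilinear expression both vanish. *)
Lemma Htilde_bilinear A (xi f : {poly R}) (Et : R) (q : {poly R}) :
  (-4 *: (c2 c * (xi * f^`(2) - 2 *: (xi^`() * f^`()) + xi^`(2) * f)
     + C1 c A * (xi * f^`()) - C1m c A * (xi^`() * f))) - Et *: (xi * f) = q ->
  toF xi * (Htilde c A xi f - toF Et%:P * toF f) = toF q.
Proof.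
move=> <-; have [->|xi0] := eqVneq xi 0.
  by rewrite [0^`(2)]derivnS derivn1 !(deriv0, mul0r, mulr0, scaler0, subr0, addr0).
have fx : toF xi != 0 by rewrite /toF tofrac_eq0.
have tofD (u v : {poly R}) : tofrac (u + v) = tofrac u + tofrac v by exact: rmorphD.
have tofN (u : {poly R}) : tofrac (- u) = - tofrac u by exact: rmorphN.
have tofM (u v : {poly R}) : tofrac (u * v) = tofrac u * tofrac v by exact: rmorphM.
have E4 : tofrac (4%:P : {poly R}) = 4 by rewrite polyCMn rmorphMn rmorph1.
have E2 : tofrac (2%:P : {poly R}) = 2 by rewrite polyCMn rmorphMn rmorph1.
rewrite /Htilde -!mul_polyC polyCN /toF in fx *.
rewrite !(tofD, tofN, tofM) E4 E2.
exact: bilinear_over_field.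
Qed.

End Gauge.

(** * Matching the prefactors with the coefficients of the operator *)

Section GaugeIdentities.
Variable R : realType.
Variable c : params R.
Variables (A : index_pair) (x : R).
Hypothesis dx : domain c x.
Local Notation p := ((size (typeI A))%:R : R).
Local Notation q := ((size (typeII A))%:R : R).
Local Notation d1 := ((c2 c)^`().[x]).
Local Notation d2 := ((c2 c)^`(2).[x]).
Local Notation e1 := ((c1 c)^`().[x]).

Lemma natr_bin2 n : 'C(n, 2)%:R = n%:R * (n%:R - 1) / 2 :> R.
Proof.
elim: n => [|n IH]; first by rewrite bin0n mul0r mul0r.
by rewrite binS bin1 natrD IH -[n.+1%:R]natr1; field.
Qed.

Lemma horner_c2 : ((c2 c).[x] = match c with Laguerre _ => x | Jacobi _ _ => 1 - x ^+ 2 end) *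
  (d1 = match c with Laguerre _ => 1 | Jacobi _ _ => - (2 * x) end) *
  (d2 = match c with Laguerre _ => 0 | Jacobi _ _ => - 2 end).
Proof.
rewrite /c2 derivnS derivn1; case: c => [g|g h].
  by rewrite derivX derivC !(hornerX, hornerC).
rewrite derivB derivC derivXn sub0r derivN derivMn derivX /= expr1.
by rewrite !(hornerD, hornerN, hornerX, hornerC, hornerXn, hornerMn); split; [split|]; ring.
Qed.

Lemma horner_c1 (b : params R) :
  ((c1 b).[x] = match b with Laguerre g => g + 2^-1 - x
     | Jacobi g h => h - g - (g + h + 1) * x end) *
  ((c1 b)^`().[x] = match b with Laguerre _ => -1 | Jacobi g h => - (g + h + 1) end).
Proof.
rewrite /c1; case: b => [g|g h].
  by rewrite derivB derivX derivC !(hornerD, hornerN, hornerX, hornerC) sub0r.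
rewrite derivB derivZ derivX derivC.
by rewrite !(hornerD, hornerN, hornerX, hornerC, hornerZ) sub0r mulr1.
Qed.

(** On the left are the coefficients created by differentiating the prefactors, on the right those
    of [exchange_identity]. The exponents of the prefactors and the parameter shifts in [C1] and
    [C1m] fit together exactly here. *)
Lemma gauge_exchange n (l := pref_log c p q (- 2^-1) x) (m := pref_log c p q 2^-1 x) :
  (size (typeI A) + size (typeII A) = n.+1)%N ->
  [/\ 2 * (c2 c).[x] * (m - l) + (C1 c A).[x] = n.+1%:R * d1 + (c1 c).[x],
      2 * (c2 c).[x] * (m - l) + (C1m c A).[x] = n%:R * d1 + (c1 c).[x] &
      (c2 c).[x] * ((m - l) ^+ 2 + pref_log' c p q 2^-1 x + pref_log' c p q (- 2^-1) x)
      + (C1 c A).[x] * m - (C1m c A).[x] * l = 'C(n.+1, 2)%:R * d2 + n.+1%:R * e1].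
Proof.
move=> pq; rewrite natr_bin2 -pq natrD.
have -> : n%:R = p + q - 1 by rewrite -natrD pq -natr1 addrK.
rewrite /C1 /C1m !horner_c2 !horner_c1 /l /m /pref_log /pref_log' /shift.
move: dx; move: p q => P Q; case: c => [g|g h] /= dx'.
  have x0 : x != 0 by rewrite lt0r_neq0.
  by split; field.
have /andP[x1 x2] := dx'.
have y1 : 1 + x != 0 by rewrite lt0r_neq0 //; lra.
have y2 : 1 - x != 0 by rewrite lt0r_neq0 //; lra.
by split; field; rewrite y1 y2.
Qed.

(** [A] is the reduced pair, while m belongs to the pair with one more entry of each type. The extra
    factor c2 in the last equation is that of [removal_identity]. *)
Lemma gauge_removal n (l := pref_log c p q (- 2^-1) x)
    (m := pref_log c (p + 1) (q + 1) 2^-1 x) :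
  (size (typeI A) + size (typeII A) = n)%N ->
  [/\ 2 * (c2 c).[x] * (m - l) + (C1 c A).[x] = (3 * n%:R + 2) * d1 + 3 * (c1 c).[x],
      2 * (c2 c).[x] * (m - l) + (C1m c A).[x] = (3 * n%:R + 1) * d1 + 3 * (c1 c).[x] &
      (c2 c).[x] * ((c2 c).[x] * ((m - l) ^+ 2 + pref_log' c (p + 1) (q + 1) 2^-1 x
         + pref_log' c p q (- 2^-1) x)
      + (C1 c A).[x] * m - (C1m c A).[x] * l) =
      2 * (n%:R * d1 + (c1 c).[x]) * ((n%:R + 1) * d1 + (c1 c).[x])
     + (c2 c).[x] * (('C(n, 2)%:R + n%:R + 1) * d2 + (n%:R + 1) * e1)].
Proof.
move=> pq; rewrite natr_bin2 -pq natrD.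
rewrite /C1 /C1m !horner_c2 !horner_c1 /l /m /pref_log /pref_log' /shift.
move: dx; move: p q => P Q; case: c => [g|g h] /= dx'.
  have x0 : x != 0 by rewrite lt0r_neq0.
  by split; field.
have /andP[x1 x2] := dx'.
have y1 : 1 + x != 0 by rewrite lt0r_neq0 //; lra.
have y2 : 1 - x != 0 by rewrite lt0r_neq0 //; lra.
by split; field; rewrite y1 y2.
Qed.

End GaugeIdentities.

(** * Bilinear identities between polynomials *)

(** Pulls out the prefactors [pi], [rho] and the signs [s], [t], with [l] and [m] the logarithmic
    derivatives; a Hirota form plus lower-order terms remains. *)
Lemma gauge_expand (T : comNzRingType) (x0 x1 x2 y0 y1 y2 l l' m m' pi rho s t b C D : T) :
  b * (s * x0 * pi * ((t * y2 + 2 * (t * y1) * m + t * y0 * (m' + m ^+ 2)) * rho)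
    - 2 * ((s * x1 + s * x0 * l) * pi * ((t * y1 + t * y0 * m) * rho))
    + (s * x2 + 2 * (s * x1) * l + s * x0 * (l' + l ^+ 2)) * pi * (t * y0 * rho))
  + C * (s * x0 * pi * ((t * y1 + t * y0 * m) * rho))
  - D * ((s * x1 + s * x0 * l) * pi * (t * y0 * rho)) =
  s * t * pi * rho * (b * (x0 * y2 - 2 * x1 * y1 + x2 * y0)
   + (2 * b * (m - l) + C) * (x0 * y1) - (2 * b * (m - l) + D) * (x1 * y0)
   + (b * ((m - l) ^+ 2 + m' + l') + C * m - D * l) * (x0 * y0)).
Proof. by ring. Qed.

Section BilinearIdentities.
Variable R : realType.
Variable c : params R.

Definition eigenjet (l : R) (d : qpoly R) := jet_on c (jet d) /\ ode_on c l (jet d).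

Lemma eigen_specI v : eigenjet (- energyI c v / 4) (specI c v).
Proof. by split; [exact: jetI_on|exact: ode_jetI]. Qed.

Lemma eigen_specII v : eigenjet (- energyII c v / 4) (specII c v).
Proof. by split; [exact: jetII_on|exact: ode_jetII]. Qed.

Lemma eigen_specP n : eigenjet (- energy c n / 4) (specP c n).
Proof. by split; [exact: jetP_on|exact: ode_jetP]. Qed.

Definition wr (ds : seq (qpoly R)) (t s : nat) (x : R) : R :=
  gwronsk t s [seq jet d x | d <- ds].

Lemma wr_derive (ds : seq (qpoly R)) (sg : R) x : domain c x ->
  (forall j, (j < size ds)%N -> jet_on c (jet (nth (specP c 0) ds j))) ->
  is_derive x 1 (fun y => sg * wr ds 0 0 y) (sg * wr ds 0 1 x) /\
  is_derive x 1 (fun y => sg * wr ds 0 1 y) (sg * (wr ds 0 2 x + wr ds 1 1 x)).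
Proof.
move=> dx H.
have H' j : (j < size (map (@jet R) ds))%N -> jet_at (nth (fun _ _ => 0) (map (@jet R) ds) j) x.
  by rewrite size_map => hj; rewrite (nth_map (specP c 0)) //; exact: H.
have E y : [seq u y | u <- map (@jet R) ds] = [seq jet d y | d <- ds] by rewrite -map_comp.
have h1 := is_derive_gwronsk00 H'; have h2 := is_derive_gwronsk01 H'.
rewrite !E in h1 h2.
rewrite (_ : (fun y => gwronsk 0 0 _) = wr ds 0 0) in h1; last first.
  by apply/funext => y; rewrite E.
rewrite (_ : (fun y => gwronsk 0 1 _) = wr ds 0 1) in h2; last first.
  by apply/funext => y; rewrite E.
split.
  by apply: (is_derive_eq (is_derive_mul (is_derive_const sg x) h1)); rewrite mul0r add0r.
by apply: (is_derive_eq (is_derive_mul (is_derive_const sg x) h2)); rewrite mul0r add0r.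
Qed.

Lemma wr_gauge (ds : seq (qpoly R)) (sg s : R) (A : index_pair) (X : {poly R}) x 
    (p := (size (typeI A))%:R) (q := (size (typeII A))%:R) 
    (l := pref_log c p q s x) (l' := pref_log' c p q s x) (pi := prefactor c A s x) :
  (forall j, (j < size ds)%N -> jet_on c (jet (nth (specP c 0) ds j))) ->
  (forall y, domain c y -> X.[y] = (sg * wr ds 0 0 y) * prefactor c A s y) ->
  domain c x ->
  [/\ X.[x] = sg * wr ds 0 0 x * pi,
      X^`().[x] = (sg * wr ds 0 1 x + sg * wr ds 0 0 x * l) * pi &
      X^`(2).[x] = (sg * (wr ds 0 2 x + wr ds 1 1 x) + 2 * (sg * wr ds 0 1 x) * l
         + sg * wr ds 0 0 x * (l' + l ^+ 2)) * pi].
Proof.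
move=> H XE dx.
apply: (@horner_gauge R c X (fun y => sg * wr ds 0 0 y) (fun y => sg * wr ds 0 1 y)
  (fun y => sg * (wr ds 0 2 y + wr ds 1 1 y)) (prefactor c A s) 
  (pref_log c p q s) (pref_log' c p q s)) => // y dy.
- by have [] := wr_derive sg dy H.
- by have [] := wr_derive sg dy H.
- exact: is_derive_prefactor.
- exact: is_derive_pref_log.
Qed.

Variables (F : seq (qpoly R)) (lF : nat -> R).
Hypothesis eigenF : forall j, (j < size F)%N -> eigenjet (lF j) (nth (specP c 0) F j).

Lemma jet_on_cat (us : seq (qpoly R)) :
  (forall j, (j < size us)%N -> jet_on c (jet (nth (specP c 0) us j))) ->
  forall j, (j < size (F ++ us))%N -> jet_on c (jet (nth (specP c 0) (F ++ us) j)).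
Proof.
move=> H j; rewrite size_cat nth_cat => hj.
have [jF|Fj] := ltnP j (size F); first by have [] := eigenF jF.
by apply: H; rewrite ltn_subLR.
Qed.

Lemma odeF_at x : domain c x -> forall j, (j < size [seq jet d x | d <- F])%N ->
  ode_jet (c2 c).[x] (c2 c)^`().[x] (c2 c)^`(2).[x] (c1 c).[x] (c1 c)^`().[x] (lF j)
    (nth (fun=> 0) [seq jet d x | d <- F] j).
Proof.
move=> dx j; rewrite size_map => hj; rewrite (nth_map (specP c 0)) //.
by have [_] := eigenF hj; exact.
Qed.

Variables (A : index_pair).

(** [a] is the new seed and [b] the replaced one. The sign [sg] of moving the exchanged column is
    common to all four functions and enters each product squared. *)
Lemma exchange_bilinear (a b d : qpoly R) (la lb ld : R) (sg : R)
    (xi xi0 P P0 : {poly R}) :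
  (size (typeI A) + size (typeII A) = (size F).+1)%N ->
  eigenjet la a -> eigenjet lb b -> eigenjet ld d ->
  (forall y, domain c y -> xi.[y] = sg * wr (F ++ [:: a]) 0 0 y * prefactor c A (- 2^-1) y) ->
  (forall y, domain c y -> xi0.[y] = sg * wr (F ++ [:: b]) 0 0 y * prefactor c A (- 2^-1) y) ->
  (forall y, domain c y -> P.[y] = sg * wr (F ++ [:: b; d]) 0 0 y * prefactor c A 2^-1 y) ->
  (forall y, domain c y -> P0.[y] = sg * wr (F ++ [:: a; d]) 0 0 y * prefactor c A 2^-1 y) ->
  c2 c * (xi * P^`(2) - 2 *: (xi^`() * P^`()) + xi^`(2) * P)
     + C1 c A * (xi * P^`()) - C1m c A * (xi^`() * P) =
  (la + lb - ld) *: (xi * P) + (2 * (ld - lb)) *: (xi0 * P0).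
Proof.
move=> sz ea eb ed hxi hxi0 hP hP0; apply: (@poly_eq_domain R c) => x dx.
have [X0 X1 X2] := wr_gauge (@jet_on_cat [:: a] (fun j => match j with
  0%N => fun=> ea.1 | _.+1 => fun h => False_ind _ (notF h) end)) hxi dx.
have [Y0 Y1 Y2] := wr_gauge (@jet_on_cat [:: b; d] (fun j => match j with
  0%N => fun=> eb.1 | 1%N => fun=> ed.1 | _.+2 => fun h => False_ind _ (notF h) end)) hP dx.
have [G1 G2 G3] := gauge_exchange dx sz.
have := exchange_identity (odeF_at dx) (ea.2 x dx) (eb.2 x dx) (ed.2 x dx).
rewrite size_map.
have wrE t s us : gwronsk t s ([seq jet d x | d <- F] ++ [seq jet d x | d <- us]) =
  wr (F ++ us) t s x by rewrite /wr map_cat.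
rewrite !(wrE _ _ [:: _]) !(wrE _ _ [:: _; _]).
rewrite !(hornerD, hornerN, hornerM, hornerZ) (hxi0 x dx) (hP0 x dx) X0 X1 X2 Y0 Y1 Y2.
move=> E; rewrite gauge_expand G1 G2 G3 E; ring.
Qed.

Lemma c2_neq0 x : domain c x -> (c2 c).[x] != 0.
Proof.
rewrite horner_c2; case: c => [g|g h] /= dx; first by rewrite lt0r_neq0.
case/andP: dx => x1 x2; have -> : 1 - x ^+ 2 = (1 + x) * (1 - x) by ring.
by rewrite mulf_neq0 // lt0r_neq0 //; lra.
Qed.

(** This is the origin of [gamma]: the exponents on the two sides differ by exactly one at each
    singular point. In the Laguerre case c2 is x itself; in the Jacobi case 1 - x^2 is 4 times the
    product of (1 - x) / 2 and (1 + x) / 2. *)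
Lemma prefactor_removal A2 x :
  size (typeI A2) = (size (typeI A)).+1 -> size (typeII A2) = (size (typeII A)).+1 ->
  domain c x ->
  prefactor c A2 (- 2^-1) x * prefactor c A 2^-1 x * (c2 c).[x] =
  gamma c / 2 * (prefactor c A (- 2^-1) x * prefactor c A2 2^-1 x).
Proof.
rewrite /prefactor horner_c2 => -> -> dx.
rewrite -[(size (typeI A)).+1%:R]natr1 -[(size (typeII A)).+1%:R]natr1.
move: ((size (typeI A))%:R : R) ((size (typeII A))%:R : R) => p q.
have powR4 (y r1 r2 r3 r4 : R) : 0 < y -> r1 + r2 + 1 = r3 + r4 ->
    powR y r1 * powR y r2 * y = powR y r3 * powR y r4.
  move=> y0 E; have h r r' : (r + r' == 0 :> R) ==> (y != 0) by rewrite lt0r_neq0 ?implybT.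
  by rewrite -{3}(powRr1 (ltW y0)) -!powRD // E.
move: dx; rewrite /gamma; case: c => [g|g h] /= dx.
  have := @powR4 x ((p + 1 + g - 2^-1) * (q + 1)) ((p + g + 2^-1) * q)
    ((p + g - 2^-1) * q) ((p + 1 + g + 2^-1) * (q + 1)) dx.
  set P1 := powR _ _; set P2 := powR _ _; set P3 := powR _ _; set P4 := powR _ _ => H.
  move: (expR _) (expR _) => e1 e2.
  transitivity (e1 * e2 * (P1 * P2 * x)); first by ring.
  by rewrite H; field.
case/andP: dx => x1 x2.
have y1 : 0 < (1 + x) / 2 by lra.
have y2 : 0 < (1 - x) / 2 by lra.
have := @powR4 _ ((p + 1 + g - 2^-1) * (q + 1)) ((p + g + 2^-1) * q)
    ((p + g - 2^-1) * q) ((p + 1 + g + 2^-1) * (q + 1)) y2.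
set P1 := powR _ _; set P2 := powR _ _; set P3 := powR _ _; set P4 := powR _ _ => H1.
have := @powR4 _ ((q + 1 + h - 2^-1) * (p + 1)) ((q + h + 2^-1) * p)
    ((q + h - 2^-1) * p) ((q + 1 + h + 2^-1) * (p + 1)) y1.
set Q1 := powR _ _; set Q2 := powR _ _; set Q3 := powR _ _; set Q4 := powR _ _ => H2.
transitivity (4 * (P1 * P2 * ((1 - x) / 2)) * (Q1 * Q2 * ((1 + x) / 2))); first by field.
by rewrite H1 ?H2; field.
Qed.

Lemma removal_bilinear A2 (a b d : qpoly R) (la lb ld : R) (sg : R)
    (xi xi0 P P0 : {poly R}) :
  size (typeI A2) = (size (typeI A)).+1 -> size (typeII A2) = (size (typeII A)).+1 ->
  (size (typeI A) + size (typeII A) = size F)%N ->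
  eigenjet la a -> eigenjet lb b -> eigenjet ld d ->
  (forall y, domain c y -> xi.[y] = 1 * wr (F ++ [::]) 0 0 y * prefactor c A (- 2^-1) y) ->
  (forall y, domain c y -> xi0.[y] = sg * wr (F ++ [:: a; b]) 0 0 y * prefactor c A2 (- 2^-1) y) ->
  (forall y, domain c y -> P.[y] = sg * wr (F ++ [:: a; b; d]) 0 0 y * prefactor c A2 2^-1 y) ->
  (forall y, domain c y -> P0.[y] = 1 * wr (F ++ [:: d]) 0 0 y * prefactor c A 2^-1 y) ->
  c2 c * (xi * P^`(2) - 2 *: (xi^`() * P^`()) + xi^`(2) * P)
     + C1 c A * (xi * P^`()) - C1m c A * (xi^`() * P) =
  (la + lb - ld) *: (xi * P) + (4 / gamma c * (ld - la) * (ld - lb)) *: (xi0 * P0).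
Proof.
move=> s1 s2 sz ea eb ed hxi hxi0 hP hP0; apply: (@poly_eq_domain R c) => x dx.
have [X0 X1 X2] := wr_gauge (@jet_on_cat [::] (fun j h => False_ind _ (notF h))) hxi dx.
have [Y0 Y1 Y2] := wr_gauge (@jet_on_cat [:: a; b; d] (fun j => match j with
  0%N => fun=> ea.1 | 1%N => fun=> eb.1 | 2 => fun=> ed.1
  | _.+3 => fun h => False_ind _ (notF h) end)) hP dx.
have [G1 G2 G3] := gauge_removal dx sz.
rewrite s1 s2 -[(size (typeI A)).+1%:R]natr1 -[(size (typeII A)).+1%:R]natr1 in Y1 Y2.
have := removal_identity (odeF_at dx) (ea.2 x dx) (eb.2 x dx) (ed.2 x dx).
rewrite size_map.
have wrE t s us : gwronsk t s ([seq jet d x | d <- F] ++ [seq jet d x | d <- us]) =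
  wr (F ++ us) t s x by rewrite /wr map_cat.
have wrE0 t s : gwronsk t s [seq jet d x | d <- F] = wr (F ++ [::]) t s x by rewrite cats0.
rewrite !(wrE _ _ [:: _]) !(wrE _ _ [:: _; _]) !(wrE _ _ [:: _; _; _]) !wrE0 => E.
rewrite !(hornerD, hornerN, hornerM, hornerZ) (hxi0 x dx) (hP0 x dx) X0 X1 X2 Y0 Y1 Y2.
(* [removal_identity] has c2^2 in its leading term, so one factor c2 is restored here and cancelled
   by injectivity. *)
rewrite gauge_expand G1 G2; apply: (mulfI (c2_neq0 dx)).
have PR := prefactor_removal s1 s2 dx; have g0 : gamma c != 0.
  by rewrite /gamma; case: (c) => *; rewrite pnatr_eq0.
rewrite -G3 in E; clear X0 X1 X2 Y0 Y1 Y2 G1 G2 G3.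
move: PR E; set pi := prefactor c A (- 2^-1) x; set rho := prefactor c A2 2^-1 x.
set pi2 := prefactor c A2 _ x; set rho1 := prefactor c A _ x => PR E.
refine (etrans _ (etrans (congr1 (fun z => sg * (pi * rho) * z) E) _)); cbv beta; first by ring.
have -> : pi * rho = 2 / gamma c * (pi2 * rho1 * (c2 c).[x]) by rewrite PR; field.
have PR' : pi2 * rho1 * (c2 c).[x] = gamma c / 2 * (pi * rho) by [].
transitivity ((la + lb - ld) * sg * (wr (F ++ [::]) 0 0 x * wr (F ++ [:: a; b; d]) 0 0 x)
    * (2 / gamma c) * (c2 c).[x] * (pi2 * rho1 * (c2 c).[x])
  + 4 / gamma c * (ld - la) * (ld - lb) * sg * (c2 c).[x]
    * (wr (F ++ [:: a; b]) 0 0 x * pi2 * (wr (F ++ [:: d]) 0 0 x * rho1))); first by ring.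
rewrite PR'; field.
exact: g0.
Qed.

End BilinearIdentities.

(** * The theorem *)

Lemma In_cat (T : Type) (p : T) s1 s2 :
  List.In p (s1 ++ s2) -> List.In p s1 \/ List.In p s2.
Proof. by elim: s1 => [|a s1 IH] /=; [right | case=> [->|/IH[]]; auto]. Qed.

Lemma In_map (T U : Type) (f : T -> U) p s :
  List.In p (map f s) -> exists v, p = f v.
Proof. by elim: s => //= a s IH [<-|/IH //]; exists a. Qed.

Section MultiIndexedPolynomials.
Variable R : realType.
Variable c : params R.
Implicit Types (A : index_pair) (n : nat) (S : seq nat).

Definition seed_specs S1 S2 : seq (qpoly R) := map (specI c) S1 ++ map (specII c) S2.

Definition seed_eigen S1 S2 (j : nat) : R :=
  nth 0 ([seq - energyI c v / 4 | v <- S1] ++ [seq - energyII c v / 4 | v <- S2]) j.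

Lemma eigen_seed_specs S1 S2 j : (j < size (seed_specs S1 S2))%N ->
  eigenjet c (seed_eigen S1 S2 j) (nth (specP c 0) (seed_specs S1 S2) j).
Proof.
rewrite /seed_specs /seed_eigen size_cat !nth_cat !size_map => hj.
case: ltnP => h; first by rewrite !(nth_map 0%N) //; exact: eigen_specI.
by rewrite !(nth_map 0%N) ?ltn_subLR //; exact: eigen_specII.
Qed.

Lemma wronskian_wr (ps : seq ((R -> R) * qpoly R)) x :
  (forall p, List.In p ps -> jet_on c (jet p.2) /\
     forall y, domain c y -> p.1 y = jet p.2 y 0%N) ->
  domain c x -> wronskian (map fst ps) x = wr (map snd ps) 0 0 x.
Proof.
move=> H dx; pose p0 : (R -> R) * qpoly R := (fun=> 0, specP c 0).
have N j : (j < size ps)%N -> List.In (nth p0 ps j) ps.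
  by elim: ps j {H} => // p ps IH [|j] /= h; [left | right; exact: IH].
rewrite (@wronskian_gwronsk _ c _ [seq jet p.2 | p <- ps]) ?size_map //.
- by rewrite /wr -!map_comp.
- by move=> j hj; rewrite (nth_map p0) //; exact: (H _ (N _ hj)).1.
- move=> j hj y dy; rewrite !(nth_map p0) //; exact: (H _ (N _ hj)).2.
Qed.

Lemma wronskian_seeds A (E : seq nat) x : domain c x ->
  wronskian (seeds c A ++ [seq horner (Defs.eigenpoly c n) | n <- E]) x =
  wr (seed_specs (typeI A) (typeII A) ++ map (specP c) E) 0 0 x.
Proof.
move=> dx.
pose ps := [seq (muI c v, specI c v) | v <- typeI A] ++
  [seq (muII c v, specII c v) | v <- typeII A] ++
  [seq (horner (Defs.eigenpoly c n), specP c n) | n <- E].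
have -> : seeds c A ++ [seq horner (Defs.eigenpoly c n) | n <- E] = map fst ps.
  by rewrite /ps !map_cat -!map_comp catA.
have -> : seed_specs (typeI A) (typeII A) ++ map (specP c) E = map snd ps.
  by rewrite /ps !map_cat -!map_comp catA.
apply: wronskian_wr => // p hp; have [h|h] := In_cat hp; last have [{}h|{}h] := In_cat h.
- by have [v ->] := In_map h; split; [exact: jetI_on|move=> y _; exact: muIE].
- by have [v ->] := In_map h; split; [exact: jetII_on|move=> y _; exact: muIIE].
- by have [v ->] := In_map h; split; [exact: jetP_on|move=> y _; exact: eigenpolyE].
Qed.

Lemma Xi_funE A x : domain c x ->
  Xi_fun c A x = wr (seed_specs (typeI A) (typeII A)) 0 0 x * prefactor c A (- 2^-1) x.
Proof.
by move=> dx; have := wronskian_seeds A [::] dx; rewrite /Xi_fun !cats0 => ->.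
Qed.

Lemma P_funE A n x : domain c x ->
  P_fun c A n x = wr (seed_specs (typeI A) (typeII A) ++ [:: specP c n]) 0 0 x
    * prefactor c A 2^-1 x.
Proof.
by move=> dx; have := wronskian_seeds A [:: n] dx; rewrite /P_fun -cats1 => ->.
Qed.

Lemma exists_Xi A : exists X, is_Xi c A X.
Proof.
have [|X HX] := @wronskian_polynomial R c A [::]; first by [].
exists X => x dx; rewrite (HX x dx) Xi_funE // sub0r catA cats0.
by [].
Qed.

Lemma exists_P A n : exists X, is_P c A n X.
Proof.
have [|X HX] := @wronskian_polynomial R c A [:: specP c n].
  by move=> d x [<-|[]].
exists X => x dx; rewrite (HX x dx) P_funE // catA.
by congr (_ * prefactor _ _ _ _); rewrite /=; field.
Qed.

Lemma wr_move (S : seq (qpoly R)) u T U x :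
  wr (S ++ u :: T ++ U) 0 0 x = (-1) ^+ size T * wr (S ++ T ++ u :: U) 0 0 x.
Proof.
rewrite /wr !map_cat /= map_cat !gwronskE -/(coldet _) coldet_move size_map.
by rewrite -/(coldet _).
Qed.

Lemma wr_move_typeI S1 v S2 T U x :
  wr (seed_specs (S1 ++ v :: S2) T ++ U) 0 0 x =
  (-1) ^+ (size S2 + size T) * wr (seed_specs (S1 ++ S2) T ++ specI c v :: U) 0 0 x.
Proof.
rewrite /seed_specs !map_cat /= -!catA /= [_ ++ map _ T ++ U]catA wr_move.
by rewrite size_cat !size_map -!catA.
Qed.

Lemma wr_move_typeII S1 v S2 T U x :
  wr (seed_specs T (S1 ++ v :: S2) ++ U) 0 0 x =
  (-1) ^+ size S2 * wr (seed_specs T (S1 ++ S2) ++ specII c v :: U) 0 0 x.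
Proof.
by rewrite /seed_specs !map_cat /= -!catA /= catA wr_move size_map -!catA.
Qed.

Lemma scale_bilinear (B X Y : {poly R}) (a b Et E2 : R) :
  B = a *: X + b *: Y -> Et = -4 * a -> E2 = -4 * b ->
  -4 *: B - Et *: X = E2 *: Y.
Proof. by move=> -> -> ->; rewrite scalerDr !scalerA addrAC subrr add0r. Qed.

Lemma eq_prefactor A A' s x : size (typeI A) = size (typeI A') ->
  size (typeII A) = size (typeII A') -> prefactor c A s x = prefactor c A' s x.
Proof. by rewrite /prefactor => -> ->. Qed.

Lemma replace_mid d e S1 S2 : uniq (S1 ++ d :: S2) ->
  replace d e (S1 ++ d :: S2) = S1 ++ e :: S2.
Proof.
rewrite uniq_catC /= mem_cat => /andP[dS _].
have keep S : d \notin S -> [seq if x == d then e else x | x <- S] = S.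
  move=> dn; rewrite -[RHS]map_id; apply/eq_in_map => x xS.
  by case: eqP => // xd; rewrite -xd xS in dn.
rewrite /replace map_cat /= eqxx !keep //; apply: contra dS => ->; rewrite ?orbT //.
Qed.

Lemma rem_mid d S1 S2 : uniq (S1 ++ d :: S2) -> rem d (S1 ++ d :: S2) = S1 ++ S2.
Proof.
elim: S1 => [|a S1 IH] /=; first by rewrite eqxx.
case/andP; rewrite mem_cat inE !negb_or => /and3P[_ /negbTE -> _] /IH.
by move=> ->.
Qed.

End MultiIndexedPolynomials.

Theorem theorem4p6 (R : realType) (c : params R) (D : index_pair) (n : nat)
    (hD : multi_index D) (hc : admissible c D) (hn : (1 <= n)%N)
    (D' : index_pair) (Et E2 : R) (hD' : EP c D n D' Et E2) :
  exists XiD XiD' PD PD' : {poly R},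
    [/\ is_Xi c D XiD, is_Xi c D' XiD', is_P c D n PD, is_P c D' n PD' &
        toF XiD' * (Htilde c D' XiD' PD - toF Et%:P * toF PD)
        = toF (E2 *: (PD' * XiD))].
Proof.
have [XiD hXiD] := exists_Xi c D; have [XiD' hXiD'] := exists_Xi c D'.
have [PD hPD] := exists_P c D n; have [PD' hPD'] := exists_P c D' n.
exists XiD, XiD', PD, PD'; split => //; apply: Htilde_bilinear.
(* Without repetitions, [replace] and [rem] act at a single position, so the pair splits around
   it. *)
have uniq_of s : sorted ltn s -> uniq s by rewrite ltn_sorted_uniq_leq => /andP[].
have [/and5P[/uniq_of uI /uniq_of uII _ _ _]] := hD.
have HXi A X : is_Xi c A X -> forall y, domain c y -> X.[y] =
    wr (seed_specs c (typeI A) (typeII A)) 0 0 y * prefactor c A (- 2^-1) y.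
  by move=> h y dy; rewrite h // Xi_funE.
have HP A X : is_P c A n X -> forall y, domain c y -> X.[y] =
    wr (seed_specs c (typeI A) (typeII A) ++ [:: specP c n]) 0 0 y * prefactor c A 2^-1 y.
  by move=> h y dy; rewrite h // P_funE.
move: (HXi _ _ hXiD) (HXi _ _ hXiD') (HP _ _ hPD) (HP _ _ hPD') => {hXiD hXiD' hPD hPD' HXi HP}.
clear hD hc; case: D' Et E2 / hD'.
- move=> d e; case: D uI uII => TI T /= uI _ dI _ _; move: uI.
  case/splitPr: dI => S1 S2 uI; rewrite (replace_mid _ uI) => h1 h2 h3 h4.
  (* The exchanged column moves past the seeds of [S2] and [T]; the sign is the same for [d] and [e]
     because the replacement keeps the position. *)
  rewrite [PD' * _]mulrC; apply: (scale_bilinear (@exchange_bilinear R c (seed_specs c (S1 ++ S2) T)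
    _ (@eigen_seed_specs R c _ _) (IndexPair (S1 ++ e :: S2) T) (specI c e) (specI c d) (specP c n)
    _ _ _ ((-1) ^+ (size S2 + size T)) _ _ _ _ _ (eigen_specI c e) (eigen_specI c d) (eigen_specP c n)
    _ _ _ _)); try by field.
  + by rewrite /seed_specs size_cat !size_map !size_cat /=; lia.
  + by move=> y dy; rewrite h2 // -[seed_specs _ _ _]cats0 wr_move_typeI.
  + move=> y dy; rewrite h1 // -[seed_specs _ _ _]cats0 wr_move_typeI; congr (_ * _).
    by apply: eq_prefactor => //=; rewrite !size_cat.
  + move=> y dy; rewrite h3 // wr_move_typeI; congr (_ * _).
    by apply: eq_prefactor => //=; rewrite !size_cat.
  + by move=> y dy; rewrite h4 // wr_move_typeI.
- move=> d e; case: D uI uII => T TII /= _ uII dII _ _; move: uII.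
  case/splitPr: dII => S1 S2 uII; rewrite (replace_mid _ uII) => h1 h2 h3 h4.
  rewrite [PD' * _]mulrC; apply: (scale_bilinear (@exchange_bilinear R c (seed_specs c T (S1 ++ S2))
    _ (@eigen_seed_specs R c _ _) (IndexPair T (S1 ++ e :: S2)) (specII c e) (specII c d) (specP c n)
    _ _ _ ((-1) ^+ size S2) _ _ _ _ _ (eigen_specII c e) (eigen_specII c d) (eigen_specP c n)
    _ _ _ _)); try by field.
  + by rewrite /seed_specs size_cat !size_map !size_cat /=; lia.
  + by move=> y dy; rewrite h2 // -[seed_specs _ _ _]cats0 wr_move_typeII.
  + move=> y dy; rewrite h1 // -[seed_specs _ _ _]cats0 wr_move_typeII; congr (_ * _).
    by apply: eq_prefactor => //=; rewrite !size_cat.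
  + move=> y dy; rewrite h3 // wr_move_typeII; congr (_ * _).
    by apply: eq_prefactor => //=; rewrite !size_cat.
  + by move=> y dy; rewrite h4 // wr_move_typeII.
move=> d k; case: D uI uII => TI TII /= uI uII dI kII; move: uI uII.
case/splitPr: dI => S1 S2 uI; case/splitPr: kII => T1 T2 uII.
rewrite (rem_mid uI) (rem_mid uII) => h1 h2 h3 h4.
(* The type I column is moved first, past all type II columns, and the type II column then stops in
   front of it; hence the order [k], [d] and the two sign factors. *)
rewrite [PD' * _]mulrC; apply: (scale_bilinear (@removal_bilinear R c (seed_specs c (S1 ++ S2) (T1 ++ T2))
    _ (@eigen_seed_specs R c _ _) (IndexPair (S1 ++ S2) (T1 ++ T2))
    (IndexPair (S1 ++ d :: S2) (T1 ++ k :: T2)) (specII c k) (specI c d) (specP c n)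
    _ _ _ ((-1) ^+ (size S2 + size (T1 ++ k :: T2)) * (-1) ^+ size T2) _ _ _ _ _ _ _
    (eigen_specII c k) (eigen_specI c d) (eigen_specP c n) _ _ _ _)).
- by rewrite /= !size_cat addnS.
- by rewrite /= !size_cat addnS.
- by rewrite /seed_specs size_cat !size_map.
- by move=> y dy; rewrite h2 // cats0 mul1r.
- move=> y dy; rewrite h1 // -[seed_specs _ _ _]cats0 wr_move_typeI wr_move_typeII.
  by rewrite !mulrA.
- by move=> y dy; rewrite h3 // wr_move_typeI wr_move_typeII !mulrA.
- by move=> y dy; rewrite h4 // mul1r.
- by field.
- by field; rewrite /gamma; case: (c) => *; rewrite pnatr_eq0.
Qed.
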